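(* Let $\mathrm{L} = P(\mathrm{D})Q(\mathrm{D})^{-1}$ be a rational operator with $\deg(P)>\deg(Q)$ and with trivial null space, with inverse $\mathrm{L}^{-1}$. Let $w$ be a Lévy white noise with Lévy exponent $f$ such that $X_{\mathrm{rect}}=\langle\mathrm{rect}_{[0,1]},w\rangle$ has zero mean and finite variance. Let $n\in\mathbb{N}$, $n\ge1$, and let $w_n = \sum_{k\in\mathbb{Z}} A_{k,n}\,\delta(\cdot-\tau_{k,n})$ be the compound-Poisson innovation with rate $\lambda_n=n$ and i.i.d. infinitely divisible amplitudes with Lévy exponent $f_n=\frac1n f$. Let $s=\mathrm{L}^{-1}w$ and $s_n=\mathrm{L}^{-1}w_n$. Then, for all $\varphi_1,\varphi_2\in\mathcal{S}(\mathbb{R})$, $$\mathbb{E}[\langle\varphi_1,s_n\rangle\langle\varphi_2,s_n\rangle] = \mathbb{E}[\langle\varphi_1,s\rangle\langle\varphi_2,s\rangle].$$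
   Context: $\mathcal{S}(\mathbb{R})$ is the Schwartz space and $\mathcal{S}'(\mathbb{R})$ the space of tempered distributions. A generalized stochastic process is a random element of $\mathcal{S}'(\mathbb{R})$. Operators: $\mathrm{D}=\frac{\mathrm{d}}{\mathrm{d}t}$, $P,Q$ are polynomials, and $\mathrm{L}=P(\mathrm{D})Q(\mathrm{D})^{-1}$ is a continuous, linear, shift-invariant operator $\mathcal{S}'(\mathbb{R})\to\mathcal{S}'(\mathbb{R})$ with frequency response $\widehat{\mathrm{L}}(\omega)=P(\mathrm{j}\omega)/Q(\mathrm{j}\omega)$, where $\mathrm{j}$ is the imaginary unit. The null space is understood in $\mathcal{S}'(\mathbb{R})$; when it is trivial, $\mathrm{L}^{-1}$ is the shift-invariant operator with frequency response $1/\widehat{\mathrm{L}}(\omega)$. The process $\mathrm{L}^{-1}w$ is defined by $\langle\varphi,\mathrm{L}^{-1}w\rangle=\langle\mathrm{L}^{-1*}\varphi,w\rangle$ for $\varphi\in\mathcal{S}(\mathbb{R})$, where $\mathrm{L}^{-1*}$ is the adjoint of $\mathrm{L}^{-1}$ (with respect to the bilinear duality pairing), and similarly for $w_n$. A real random variable $X$ is infinitely divisible if for every $M\ge 1$ it can be written (in law) as a sum of $M$ i.i.d. random variables. Its Lévy exponent is the continuous function $f:\mathbb{R}\to\mathbb{C}$ with $f(0)=0$ and $\mathbb{E}[e^{\mathrm{j}\xi X}]=e^{f(\xi)}$. A Lévy white noise $w$ with Lévy exponent $f$ is a generalized stochastic process that is stationary, has independent values on test functions with disjoint supports, and satisfies,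 for all $\varphi\in\mathcal{S}(\mathbb{R})$ and $\xi\in\mathbb{R}$, $\mathbb{E}[e^{\mathrm{j}\xi\langle\varphi,w\rangle}]=\exp\big(\int_{\mathbb{R}}f(\xi\varphi(r))\,\mathrm{d}r\big)$. The function $\mathrm{rect}_{[0,1]}$ equals $1$ for $0<x\le1$ and $0$ otherwise. The random variable $X_{\mathrm{rect}}=\langle\mathrm{rect}_{[0,1]},w\rangle$ is well defined by extension and is infinitely divisible with Lévy exponent $f$. Compound-Poisson innovation of rate $\lambda$: $\sum_{k\in\mathbb{Z}}A_k\delta(\cdot-\tau_k)$, where $(\tau_k)$ are the points of a homogeneous Poisson point process on $\mathbb{R}$ of rate $\lambda$ (the number of points in $[a,b]$ is Poisson with parameter $\lambda(b-a)$) and $(A_k)$ is an i.i.d. sequence independent of the locations. It is itself a Lévy white noise. *)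

(* Defs.v *)
Set Warnings "-notation-overridden,-notation-incompatible-prefix,-ambiguous-paths".
From HB Require Import structures.
From mathcomp Require Import all_boot all_order all_algebra.
From mathcomp Require Import complex.
From mathcomp Require Import all_classical all_reals all_analysis measurable_realfun.

Set Implicit Arguments.
Unset Strict Implicit.
Unset Printing Implicit Defensive.

Import Order.TTheory GRing.Theory Num.Theory.
Import numFieldNormedType.Exports.

Local Open Scope classical_set_scope.
Local Open Scope ring_scope.

Local Notation "f ^` ()" := (derive1 f) : ring_scope.
Local Notation "f ^` ( n )" := (derive1n n f) : ring_scope.

Section smooth_functions.
Context {R : realType}.
Implicit Types (phi psi : R -> R) (n : nat).

Definition smooth phi := forall n x, derivable (phi^`(n)) x 1.

Lemma derive1nZD a phi psi n : smooth phi -> smooth psi ->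
  (a *: phi + psi)^`(n) = a *: phi^`(n) + psi^`(n).
Proof.
move=> sphi spsi; elim: n => [//|n IH].
rewrite derive1nS IH; apply/funext => x.
rewrite derive1E deriveD; [|exact/derivableZ/sphi|exact: spsi].
rewrite deriveZ; [|exact: sphi].
rewrite -!derive1E; exact: erefl.
Qed.

Lemma is_derive1_translate phi h x : derivable phi (x - h) 1 ->
  is_derive x 1 (fun y => phi (y - h)) (phi^`() (x - h)).
Proof.
rewrite derive1E; set g := fun y => _.
have gE : (fun k : R => k^-1 *: ((g \o shift x) (k *: 1) - g x)) =
    (fun k : R => k^-1 *: ((phi \o shift (x - h)) (k *: 1) - phi (x - h))).
  by apply/funext => k; rewrite /g /= addrA.
by move=> dphi; split; rewrite /derivable /derive gE.
Qed.

Lemma derive1n_translate phi h n : smooth phi ->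
  (fun y => phi (y - h))^`(n) = (fun y => phi^`(n) (y - h)).
Proof.
move=> sphi; elim: n => [//|n IH].
rewrite derive1nS IH; apply/funext => x; rewrite derive1E.
by have [_ ->] := is_derive1_translate (sphi n (x - h)).
Qed.

End smooth_functions.

Section schwartz_space.
Context {R : realType}.

Definition is_schwartz (phi : R -> R) :=
  smooth phi /\
  forall k n, exists C, forall x, `|x ^+ k * phi^`(n) x| <= C.

Definition schwartz_pred : {pred R -> R} := mem [set phi | is_schwartz phi].

Lemma schwartz_submod_closed : submod_closed schwartz_pred.
Proof.
split=> [|a phi psi]; rewrite !inE.
  have d0 n : (0 : R -> R)^`(n) = 0.
    by elim: n => [//|n IH]; rewrite derive1nS IH; apply/funext=> x;
      rewrite derive1E derive_cst.
  split=> [n x|k n]; rewrite d0; first exact: derivable_cst.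
  by exists 0 => x; rewrite mulr0 normr0.
move=> [sphi bphi] [spsi bpsi]; split=> [n x|k n].
  rewrite derive1nZD //.
  by apply: derivableD; [exact/derivableZ/sphi|exact: spsi].
have [C HC] := bphi k n; have [D HD] := bpsi k n.
exists (`|a| * C + D) => x; rewrite derive1nZD //=.
rewrite mulrDr (le_trans (ler_normD _ _))// lerD //.
by rewrite /GRing.scale/= mulrCA normrM ler_wpM2l.
Qed.

HB.instance Definition _ :=
  GRing.isSubmodClosed.Build R (R -> R) schwartz_pred schwartz_submod_closed.

Record schwartz := Schwartz {
  schwartz_val :> R -> R;
  _ : schwartz_val \in schwartz_pred }.

HB.instance Definition _ := [isSub of schwartz for schwartz_val].
HB.instance Definition _ := [Choice of schwartz by <:].
HB.instance Definition _ := [SubChoice_isSubLmodule of schwartz by <:].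

Lemma schwartzP (phi : schwartz) : is_schwartz phi.
Proof. by have := valP phi; rewrite inE. Qed.

End schwartz_space.
Arguments schwartz R : clear implicits.

Section schwartz_topology.
Context {R : realType}.

(* The topology of the seminorms phi |-> sup_x |x ^+ k * phi^`(n) x|. *)
Definition schwartz_jet (phi : schwartz R) :
    prod_topology (fun _ : nat * nat => {uniform R -> R}) :=
  fun kn => fun x => x ^+ kn.1 * phi^`(kn.2) x.

HB.instance Definition _ :=
  Uniform.copy (schwartz R) (initial_topology schwartz_jet).

Lemma schwartz_jet_continuous k n :
  continuous (fun phi : schwartz R => schwartz_jet phi (k, n)).
Proof.
move=> phi.
apply: (@continuous_comp _ _ _ schwartz_jet
  (@proj _ (fun _ : nat * nat => {uniform R -> R}) (k, n))).
  exact: initial_continuous.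
exact: proj_continuous.
Qed.

Lemma near_schwartz (phi : schwartz R) k n e : 0 < e ->
  {near phi, forall psi : schwartz R,
    forall x, `|x ^+ k * (phi^`(n) x - psi^`(n) x)| < e}.
Proof.
move=> e0; have := @schwartz_jet_continuous k n phi.
move=> /(_ [set g | forall x, `|x ^+ k * phi^`(n) x - g x| < e]).
case.
  apply/uniform_nbhs; exists [set xy | `|xy.1 - xy.2| < e]; split.
    by apply: (entourage_ball _ (PosNum e0)).
  by move=> g /= + x; apply.
move=> A [oA ? AB]; exists A; split=> // psi /AB /= H x.
by rewrite mulrBr.
Qed.

Lemma schwartz_continuousP (X : topologicalType) (F : X -> schwartz R) :
  (forall k n a e, 0 < e -> \forall b \near a,
    forall x, `|x ^+ k * ((F a)^`(n) x - (F b)^`(n) x)| < e) ->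
  continuous F.
Proof.
move=> H; apply: continuous_comp_initial => a; apply/cvg_sup => -[k n].
apply: (@continuous_comp_initial _ X _
  (@proj _ (fun _ : nat * nat => {uniform R -> R}) (k, n))) => {}a.
move=> U /uniform_nbhs[E []]; rewrite -entourage_ballE => -[e /= e0 eE] EU.
have := H k n a e e0; apply: filterS => b Hb.
apply: EU => x _; apply: eE => /=; rewrite /ball /=.
by rewrite /schwartz_jet /= -mulrBr.
Qed.

End schwartz_topology.

Section schwartz_translate.
Context {R : realType}.
Implicit Types phi : schwartz R.

Let exprD_le (k : nat) (x h : R) :
  `|x ^+ k| <= 2 ^+ k * (`|(x - h) ^+ k| + `|h| ^+ k).
Proof.
rewrite !normrX; set y := `|x - h|; set z := `|h|.
have xyz : `|x| <= y + z.
  by rewrite (le_trans _ (ler_normD _ _))// subrK.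
pose M := Num.max y z.
have M0 : 0 <= M by rewrite le_max normr_ge0.
apply: (@le_trans _ _ ((2 * M) ^+ k)).
  apply: lerXn2r; rewrite ?nnegrE ?normr_ge0 ?mulr_ge0//.
  by rewrite (le_trans xyz)// mulr_natl mulr2n lerD// le_max lexx ?orbT.
rewrite exprMn ler_wpM2l// ?exprn_ge0//.
by rewrite /M; case: (leP y z) => _; rewrite ?lerDr ?lerDl exprn_ge0 ?normr_ge0.
Qed.

Let translate_le (k : nat) (h x : R) (g : R -> R) :
  `|x ^+ k * g (x - h)| <=
  2 ^+ k * (`|(x - h) ^+ k * g (x - h)| + `|h| ^+ k * `|(x - h) ^+ 0 * g (x - h)|).
Proof.
rewrite expr0 mul1r !normrM -mulrDl mulrA ler_wpM2r //; exact: exprD_le.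
Qed.

Lemma translate_subproof (h : R) phi :
  (fun x => phi (x - h)) \in schwartz_pred.
Proof.
have [sphi bphi] := schwartzP phi.
rewrite inE; split=> [n x|k n].
  by rewrite derive1n_translate//; have [] := is_derive1_translate (sphi n (x - h)).
have [C HC] := bphi k n; have [D HD] := bphi 0%N n.
exists (2 ^+ k * (C + `|h| ^+ k * D)) => x.
rewrite derive1n_translate// (le_trans (translate_le k h x _))//.
by rewrite ler_wpM2l ?exprn_ge0// lerD// ler_wpM2l ?exprn_ge0.
Qed.

(* phi (. - h) *)
Definition translate h phi : schwartz R := Schwartz (translate_subproof h phi).

Lemma translate_continuous h : continuous (translate h).
Proof.
apply: schwartz_continuousP => k n phi e e0.
pose c := 2 ^+ k * (1 + `|h| ^+ k) : R.
have c0 : 0 < c by rewrite mulr_gt0 ?exprn_gt0// ltr_pwDl// exprn_ge0.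
have dn (psi : schwartz R) x : (translate h psi)^`(n) x = psi^`(n) (x - h).
  by rewrite /translate /= derive1n_translate//; have [] := schwartzP psi.
have d0 : 0 < e / c by rewrite divr_gt0.
near=> psi => x; rewrite !dn.
have Hk : `|(x - h) ^+ k * (phi^`(n) (x - h) - psi^`(n) (x - h))| < e / c.
  by move: (x - h); near: psi; exact: near_schwartz.
have H0 : `|(x - h) ^+ 0 * (phi^`(n) (x - h) - psi^`(n) (x - h))| < e / c.
  by move: (x - h); near: psi; exact: near_schwartz.
rewrite (le_lt_trans (translate_le k h x (fun y => phi^`(n) y - psi^`(n) y)))//.
rewrite (_ : e = 2 ^+ k * (e / c + `|h| ^+ k * (e / c))); last first.
  by rewrite -[X in _ * (X + _)]mul1r -mulrDl mulrA -/c mulrCA divff ?mulr1// gt_eqF.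
rewrite ltr_pM2l ?exprn_gt0// ltr_leD// ler_wpM2l ?exprn_ge0//; exact: ltW.
Unshelve. all: by end_near. Qed.

Lemma translate_linear h : linear (translate h).
Proof. by move=> a phi psi; exact/val_inj. Qed.

End schwartz_translate.

Section tempered_distributions.
Context {R : realType}.

Definition is_tempered (u : schwartz R -> R) := scalar u /\ continuous u.

Definition tempered_pred : {pred schwartz R -> R} :=
  mem [set u | is_tempered u].

Lemma tempered_submod_closed : submod_closed tempered_pred.
Proof.
split=> [|a u v]; rewrite !inE.
  by split=> [b phi psi|phi]; [rewrite /= mulr0 addr0|exact: (@cst_continuous _ _ (0 : R))].
move=> [lu cu] [lv cv]; split=> [b phi psi|phi].
  by rewrite !fctE lu lv /= /GRing.scale /=; rewrite !mulrDr mulrCA addrACA.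
apply: continuousD; last exact: cv.
by apply: continuousM; [exact: cst_continuous|exact: cu].
Qed.

HB.instance Definition _ := GRing.isSubmodClosed.Build R (schwartz R -> R)
  tempered_pred tempered_submod_closed.

Record tempered := Tempered {
  tempered_val :> schwartz R -> R;
  _ : tempered_val \in tempered_pred }.

HB.instance Definition _ := [isSub of tempered for tempered_val].
HB.instance Definition _ := [Choice of tempered by <:].
HB.instance Definition _ := [SubChoice_isSubLmodule of tempered by <:].

Lemma temperedP (u : tempered) : is_tempered u.
Proof. by have := valP u; rewrite inE. Qed.

(* The weak-* topology. *)
Definition tempered_eval (u : tempered) : {ptws schwartz R -> R} := u.

HB.instance Definition _ :=
  Uniform.copy tempered (initial_topology tempered_eval).

Lemma delta_subproof (x : R) : (fun phi : schwartz R => phi x) \in tempered_pred.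
Proof.
rewrite inE; split=> // phi; apply/(@cvgrPdist_lt _ _ _ _ (nbhs_filter phi)) => e e0.
apply: filterS (@near_schwartz _ phi 0 0 e e0) => psi /(_ x).
by rewrite expr0 mul1r !derive1n0.
Qed.

Definition delta x : tempered := Tempered (delta_subproof x).

Lemma tempered_translate_subproof (h : R) (u : tempered) :
  (fun phi : schwartz R => u (translate (- h) phi)) \in tempered_pred.
Proof.
have [lu cu] := temperedP u.
rewrite inE; split=> [a phi psi|phi]; first by rewrite translate_linear lu.
apply: (@continuous_comp _ _ _ (translate (- h)) u); last exact: cu.
exact: translate_continuous.
Qed.

(* u (. - h), by duality. *)
Definition tempered_translate h u : tempered :=
  Tempered (tempered_translate_subproof h u).

End tempered_distributions.
Arguments tempered R : clear implicits.

Section complex_integration.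
Context d (T : measurableType d) (R : realType).
Variable mu : {measure set T -> \bar R}.

Definition cintegrable (g : T -> R[i]) :=
  mu.-integrable [set: T] (fun x => (complex.Re (g x))%:E) /\
  mu.-integrable [set: T] (fun x => (complex.Im (g x))%:E).

Definition cintegral (g : T -> R[i]) : R[i] :=
  ((\int[mu]_x complex.Re (g x)) +i* (\int[mu]_x complex.Im (g x)))%C.

End complex_integration.

Definition cexp {R : realType} (z : R[i]) : R[i] :=
  ((expR (complex.Re z) * cos (complex.Im z)) +i*
   (expR (complex.Re z) * sin (complex.Im z)))%C.

Section operators.
Context {R : realType}.
Local Notation leb := (@lebesgue_measure R).
Implicit Types (u : tempered R) (L : tempered R -> tempered R) (H : R -> R[i]).

Definition fourier (phi : R -> R) (omega : R) : R[i] :=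
  cintegral leb (fun t => ((phi t)%:C * cexp (0 +i* (- (omega * t))))%C).

(* The Fourier transform of u, defined by <phi, F u> = <F phi, u>, is the
   function H. For a real Schwartz function phi, F phi = a + i b with a and b
   real Schwartz functions, so that <F phi, u> = u a + i (u b); by linearity,
   real phi suffice to determine F u. *)
Definition is_fourier_transform u H :=
  (forall phi : schwartz R,
    cintegrable leb (fun omega => (phi omega)%:C%C * H omega)) /\
  forall phi a b : schwartz R,
    (forall omega, fourier phi omega = (a omega +i* b omega)%C) ->
    (u a +i* u b)%C = cintegral leb (fun omega => (phi omega)%:C%C * H omega).

Definition lsi_operator L :=
  [/\ linear L, continuous L &
      forall h u, L (tempered_translate h u) = tempered_translate h (L u)].

(* The Fourier transform of the impulse response. *)
Definition frequency_response L H := is_fourier_transform (L (delta 0)) H.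

Definition rational_response (P Q : {poly R[i]}) (omega : R) : R[i] :=
  P.[(0 +i* omega)%C] / Q.[(0 +i* omega)%C].

(* P and Q may have complex coefficients, but L acts on real distributions, so
   that P(i omega) / Q(i omega) is Hermitian in omega. *)
Definition rational_operator (P Q : {poly R[i]}) L :=
  [/\ Q != 0, lsi_operator L & frequency_response L (rational_response P Q)].

Definition trivial_null_space L := forall u, L u = 0 -> u = 0.

Definition inverse_operator (P Q : {poly R[i]})
    (Linv : tempered R -> tempered R) :=
  lsi_operator Linv /\
  frequency_response Linv (fun omega => (rational_response P Q omega)^-1).

Definition adjoint_operator L (Ladj : schwartz R -> schwartz R) :=
  forall (phi : schwartz R) u, (L u) phi = u (Ladj phi).

End operators.

Section independence.
Context d (T : measurableType d) (R : realType) (P : probability T R).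

Definition joint_event d' (T' : measurableType d') (I : Type) (X : I -> T -> T')
    (s : seq I) (B : I -> set T') : set T :=
  \big[setI/setT]_(i <- s) (X i @^-1` B i).

Definition independent_family d' (T' : measurableType d') (I : eqType)
    (X : I -> T -> T') :=
  forall (s : seq I) (B : I -> set T'), uniq s -> (forall i, measurable (B i)) ->
  P (joint_event X s B) = (\prod_(i <- s) P (X i @^-1` B i))%E.

Definition independent_families (I J : eqType) (X : I -> T -> R)
    (Y : J -> T -> R) :=
  forall (s : seq I) (s' : seq J) (B : I -> set R) (B' : J -> set R),
  (forall i, measurable (B i)) -> (forall j, measurable (B' j)) ->
  P (joint_event X s B `&` joint_event Y s' B') =
  (P (joint_event X s B) * P (joint_event Y s' B'))%E.

Definition independent_pair (X Y : T -> R) :=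
  forall A B : set R, measurable A -> measurable B ->
  P (X @^-1` A `&` Y @^-1` B) = (P (X @^-1` A) * P (Y @^-1` B))%E.

Definition iid (I : eqType) (X : I -> T -> R) :=
  independent_family X /\
  forall i j (B : set R), measurable B -> P (X i @^-1` B) = P (X j @^-1` B).

End independence.

Section levy_exponents.
Context {R : realType}.

Definition characteristic_function d (T : measurableType d)
    (P : probability T R) (X : T -> R) (xi : R) : R[i] :=
  cintegral P (fun t => cexp (0 +i* (xi * X t))%C).

Definition infinitely_divisible d (T : measurableType d)
    (P : probability T R) (X : {RV P >-> R}) :=
  forall M : nat, (0 < M)%N ->
  exists d' (T' : measurableType d') (P' : probability T' R)
    (Y : 'I_M -> {RV P' >-> R}),
    iid P' (fun i => Y i : T' -> R) /\
    forall B : set R, measurable B ->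
      P (X @^-1` B) = P' ((fun t => \sum_(i < M) Y i t) @^-1` B).

Definition has_levy_exponent d (T : measurableType d)
    (P : probability T R) (X : {RV P >-> R}) (f : R -> R[i]) :=
  [/\ infinitely_divisible X,
      continuous (fun xi => complex.Re (f xi)) /\
      continuous (fun xi => complex.Im (f xi)),
      f 0 = 0 &
      forall xi, characteristic_function P X xi = cexp (f xi)].

Definition levy_exponent (f : R -> R[i]) :=
  exists d (T : measurableType d) (P : probability T R) (X : {RV P >-> R}),
    has_levy_exponent X f.

End levy_exponents.

Section processes.
Context d (T : measurableType d) (R : realType) (P : probability T R).

(* Measurability with respect to the cylinder sigma-algebra, which is the Borel
   sigma-algebra of the space of tempered distributions. *)
Record generalized_process := GeneralizedProcess {
  process_val :> T -> tempered R;
  process_measurable : forall phi : schwartz R,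
    measurable_fun [set: T] (fun t => process_val t phi) }.

Implicit Types w : generalized_process.

(* Equality of the laws of w (. - h) and w on the cylinder sets, which
   generate the sigma-algebra. *)
Definition stationary w :=
  forall (h : R) (m : nat) (phi : 'I_m -> schwartz R) (B : 'I_m -> set R),
  (forall i, measurable (B i)) ->
  P [set t | forall i, B i (tempered_translate h (w t) (phi i))] =
  P [set t | forall i, B i (w t (phi i))].

Definition tsupport (phi : R -> R) : set R := closure [set x | phi x != 0].

Definition independent_values w :=
  forall phi psi : schwartz R, tsupport phi `&` tsupport psi = set0 ->
  independent_pair P (fun t => w t phi) (fun t => w t psi).

Definition levy_white_noise w (f : R -> R[i]) :=
  [/\ levy_exponent f, stationary w, independent_values w &
      forall (phi : schwartz R) (xi : R),
        cintegrable lebesgue_measure (fun r => f (xi * phi r)) /\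
        characteristic_function P (fun t => w t phi) xi =
          cexp (cintegral lebesgue_measure (fun r => f (xi * phi r)))].

(* X is the value <g, w> obtained by extending w to bounded compactly supported
   functions g: it is the limit in probability of <phi_m, w> along test functions
   converging boundedly to g with supports in a common compact set. For a Lévy
   white noise the limit exists and does not depend on the approximating
   sequence, since int f(xi (phi_m - phi'_m)) -> 0 for any two of them. *)
Definition extended_value w (g : R -> R) (X : T -> R) :=
  exists phi_ : nat -> schwartz R,
  [/\ exists C, forall m x, `|phi_ m x| <= C,
      exists K, forall m x, K < `|x| -> phi_ m x = 0,
      {ae lebesgue_measure, forall x, phi_ m x @[m --> \oo] --> g x} &
      forall e, 0 < e ->
        P [set t | e <= `|w t (phi_ m) - X t|] @[m --> \oo] --> 0%E].

Definition rect01 : R -> R := \1_`]0, 1].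

Definition point_count (tau : int -> T -> R) (B : set R) (t : T) : \bar R :=
  counting [set k | B (tau k t)].

Definition poisson_process (lambda : R) (tau : int -> T -> R) :=
  (forall a b, a < b -> forall m : nat,
     P [set t | point_count tau `[a, b] t = m%:R%:E] =
     (poisson_pmf (lambda * (b - a)) m)%:E) /\
  (forall (m : nat) (B : 'I_m -> set R), (forall i, measurable (B i)) ->
     trivIset [set: 'I_m] B ->
     independent_family P (fun i => point_count tau (B i))).

(* The series over the integers is the limit, for the topology of tempered
   distributions, of its symmetric partial sums (indices -K, ..., K). *)
Definition compound_poisson_innovation (lambda : R) (tau A : int -> {RV P >-> R}) w :=
  [/\ poisson_process lambda (fun k => tau k : T -> R),
      iid P (fun k => A k : T -> R),
      independent_families P (fun k => A k : T -> R) (fun k => tau k : T -> R) &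
      {ae P, forall t,
        \sum_(i < K.*2.+1)
           A (i%:Z - K%:Z) t *: delta (tau (i%:Z - K%:Z) t) @[K --> \oo]
        --> w t}].

(* The process s = L w, where Ladj is the adjoint of L. *)
Definition filtered_process (Ladj : schwartz R -> schwartz R) w
    (s : generalized_process) :=
  forall (phi : schwartz R) t, s t phi = w t (Ladj phi).

End processes.
Arguments generalized_process {d} T R.
Arguments rect01 {R} _.

(* Main.v *)
Require Import Defs.
Set Warnings "-notation-overridden,-notation-incompatible-prefix".
From HB Require Import structures.
From mathcomp Require Import all_boot all_order all_algebra.
From mathcomp Require Import complex.
From mathcomp Require Import all_classical all_reals all_analysis measurable_realfun.
From mathcomp Require Import ring lra zify.

Set Implicit Arguments.
Unset Strict Implicit.
Unset Printing Implicit Defensive.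

Import Order.TTheory GRing.Theory Num.Theory.
Import numFieldNormedType.Exports.

Local Open Scope classical_set_scope.
Local Open Scope ring_scope.

(** By the definition of a filtered process, <phi, L^-1 w> = <psi, w> with the
    Schwartz function psi = L^-1* phi, and likewise for w_n. So it suffices that
    w and w_n have the same second moments on Schwartz functions. By polarization
    ([second_moment_polarization]) this reduces to
    E[<psi, w>^2] = E[<psi, w_n>^2] for every psi, and both sides turn out to be
    s times the integral of psi^2, where s is the variance of X_rect.

    White noise. The characteristic function of X_rect is exp f, by approximation
    of the indicator function of ]0, 1] by test functions ([extended_value_cf]).
    As X_rect has mean 0 and variance s, this gives
    f(u) = - s u^2 / 2 + o(u^2) at the origin ([levy_exponent_quad]). The
    characteristic function of <psi, w> is the exponential of the integral of
    f(xi psi), which is - s xi^2 / 2 times the integral of psi^2, up to o(xi^2).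
    An expansion of this kind determines the second moment
    ([second_moment_of_quad]), whence [white_noise_second_moment].

    Compound-Poisson innovation. By the same expansion, applied to f/n, the
    amplitudes have mean 0 and variance s/n ([amplitude_moments]). Now
    <psi, w_n> is the almost sure limit of the symmetric partial sums of
    A_k psi(tau_k). These variables are orthogonal in L2 because the amplitudes
    are centred and independent of each other and of the locations
    ([marks_orthogonal]), so their sum converges in L2 as well and the second
    moments add up ([integral_sqr_orthogonal_series]), to s/n times the sum of
    E[psi(tau_k)^2] over k. The latter is n times the integral of psi^2, by
    Campbell's formula ([campbell]): the mean number of points in [a, b] is
    n (b - a), so the mean measure of the points is n times the Lebesgue
    measure. *)

(** * Elementary inequalities *)

Section elementary_bounds.
Context {R : realType}.
Implicit Types x a : R.

(** The bounds on the cosine and the sine below come from one another by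
    integration, starting with cos <= 1: each is this lemma applied to the
    difference of its two sides. *)
Lemma ge0_of_derive (f df : R -> R) x :
  (forall y : R, is_derive y 1 f (df y)) -> f 0 = 0 ->
  (forall y, 0 <= y -> 0 <= df y) -> 0 <= x -> 0 <= f x.
Proof.
move=> fdf f0 df0; rewrite le_eqVlt => /predU1P[<-|x0]; first by rewrite f0.
have cf : {within `[0, x], continuous f}.
  apply: continuous_subspaceT => y.
  by apply: differentiable_continuous; apply/derivable1_diffP; have [] := fdf y.
have [c] := MVT x0 (fun y _ => fdf y) cf.
rewrite in_itv/= f0 !subr0 => /andP[c0 _] ->.
by rewrite mulr_ge0 ?df0 ?ltW.
Qed.

Let sin_le x : 0 <= x -> sin x <= x.
Proof.
move=> x0; rewrite -subr_ge0.
apply: (@ge0_of_derive (fun y => y - sin y) (fun y => 1 - cos y)) => //.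
by rewrite sin0 subr0.
Qed.

Lemma one_sub_cos_le x : 1 - cos x <= x ^+ 2 / 2.
Proof.
wlog x0 : x / 0 <= x => [hw|].
  have [/hw//|/ltW x0] := leP 0 x.
  by rewrite -cosN -sqrrN; apply: hw; rewrite oppr_ge0.
rewrite -subr_ge0.
apply: (@ge0_of_derive (fun y => y ^+ 2 / 2 - (1 - cos y)) (fun y => y - sin y)) => //.
- move=> y; apply: is_derive_eq; rewrite /GRing.scale/=; by field.
- by rewrite cos0 expr0n/= mul0r !subrr.
- by move=> y y0; rewrite subr_ge0 sin_le.
Qed.

Let sub_sin_le x : 0 <= x -> x - sin x <= x ^+ 3 / 6.
Proof.
move=> x0; rewrite -subr_ge0.
apply: (@ge0_of_derive (fun y => y ^+ 3 / 6 - (y - sin y))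
  (fun y => y ^+ 2 / 2 - (1 - cos y))) => //.
- move=> y; apply: is_derive_eq; rewrite /GRing.scale/=; by field.
- by rewrite sin0 expr0n/= mul0r !subrr.
- by move=> y y0; rewrite subr_ge0 one_sub_cos_le.
Qed.

Lemma one_sub_cos_ge x : x ^+ 2 / 2 - x ^+ 4 / 24 <= 1 - cos x.
Proof.
wlog x0 : x / 0 <= x => [hw|].
  have [/hw//|/ltW x0] := leP 0 x.
  rewrite -cosN -(sqrrN x) (_ : x ^+ 4 = (- x) ^+ 4); first by apply: hw; rewrite oppr_ge0.
  by rewrite exprNn/= -signr_odd/= expr0 mul1r.
rewrite -subr_ge0.
apply: (@ge0_of_derive (fun y => 1 - cos y - (y ^+ 2 / 2 - y ^+ 4 / 24))
  (fun y => y ^+ 3 / 6 - (y - sin y))) => //.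
- move=> y; apply: is_derive_eq; rewrite /GRing.scale/=; by field.
- by rewrite cos0 !expr0n/= !mul0r !subrr.
- by move=> y y0; rewrite subr_ge0 sub_sin_le.
Qed.

Lemma abs_sub_sin_le3 x : `|x - sin x| <= `|x| ^+ 3 / 6.
Proof.
wlog x0 : x / 0 <= x => [hw|].
  have [/hw//|/ltW x0] := leP 0 x.
  by rewrite -normrN -(normrN x) opprD -sinN; apply: hw; rewrite oppr_ge0.
by rewrite !ger0_norm ?sub_sin_le// subr_ge0 sin_le.
Qed.

Lemma abs_sin_le x : `|sin x| <= `|x|.
Proof.
wlog x0 : x / 0 <= x => [hw|].
  have [/hw//|/ltW x0] := leP 0 x.
  by rewrite -normrN -(normrN x) -sinN; apply: hw; rewrite oppr_ge0.
rewrite (ger0_norm x0) ler_norml sin_le// andbT.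
have [x1|/ltW x1] := leP 1 x; last first.
  have := sub_sin_le x0; have := sin_le x0; nra.
by have := sin_geN1 x; lra.
Qed.

Lemma abs_sub_sin_le2 x : `|x - sin x| <= 2 * x ^+ 2.
Proof.
have [x1|/ltW x1] := leP `|x| 1.
  apply: le_trans (abs_sub_sin_le3 x) _.
  by rewrite -(real_normK (num_real x)); have := normr_ge0 x; nra.
apply: le_trans (ler_normB _ _) _; have := abs_sin_le x.
by rewrite -(real_normK (num_real x)); have := normr_ge0 x; nra.
Qed.

Lemma abs_cos_sub_le x y : `|cos x - cos y| <= `|x - y|.
Proof.
wlog xy : x y / x <= y => [hw|].
  have [/hw//|/ltW xy] := leP x y.
  by rewrite -normrN -(normrN (x - y)) !opprB; apply: hw.
have [->|] := eqVneq x y; first by rewrite !subrr.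
move=> /negbTE xney; have {xney}xy' : x < y by rewrite lt_neqAle xney.
have [|c _ /= E] := @MVT R cos (fun z => - sin z) x y xy' (fun z _ => is_derive_cos z).
  by apply: continuous_subspaceT => z; exact: continuous_cos.
rewrite distrC (distrC x) E normrM normrN ler_piMl// sin_max//.
Qed.

Lemma abs_sin_sub_le x y : `|sin x - sin y| <= `|x - y|.
Proof.
by have := abs_cos_sub_le (x - pi / 2) (y - pi / 2); rewrite !cosBpihalf opprB addrA subrK.
Qed.

(** The upper bound is exp(a) <= 1/(1 - a), that is exp(-a) >= 1 - a. *)
Lemma expR_sub_le a : `|a| <= 1/2 -> `|expR a - 1 - a| <= 2 * a ^+ 2.
Proof.
move=> a2; have := expR_ge1Dx a; have := expR_ge1Dx (- a) => h1 h2.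
rewrite ger0_norm; last by lra.
move: a2; rewrite ler_norml => /andP[a1 a2].
have h3 : expR a * expR (- a) = 1 by rewrite -expRD subrr expR0.
have := expR_gt0 a => h4.
have h5 : expR a * (1 - a) <= 1 by rewrite -[leRHS]h3 ler_wpM2l// ltW.
nra.
Qed.

End elementary_bounds.

(** * Second-order expansions at the origin *)

Section quadratic_expansion.
Context {R : realType}.
Implicit Types (g h : R -> R) (c : R).

(** The expansion g(x) = c x^2 + o(x^2) as x -> 0, as inequalities that can be
    integrated: they hold without exception on a neighbourhood of 0. *)
Definition quad g c :=
  forall e, 0 < e -> \forall x \near (0 : R), `|g x - c * x ^+ 2| <= e * x ^+ 2.

Lemma near0_abs_le (e : R) : 0 < e -> \forall x \near (0 : R), `|x| <= e.
Proof.
move=> e0; have /cvgrPdist_le/(_ e e0) : (x : R) @[x --> 0] --> (0 : R) by exact: cvg_id.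
by apply: filterS => x; rewrite sub0r normrN.
Qed.

Lemma quadD g h a b : quad g a -> quad h b -> quad (fun x => g x + h x) (a + b).
Proof.
move=> qg qh e e0.
have e2 : 0 < e / 2 by rewrite divr_gt0.
apply: filterS2 (qg _ e2) (qh _ e2) => x H1 H2.
rewrite mulrDl opprD addrACA (le_trans (ler_normD _ _))//.
by rewrite (splitr e) mulrDl lerD.
Qed.

Lemma quadZ k g a : quad g a -> quad (fun x => k * g x) (k * a).
Proof.
move=> qg e e0; near=> x.
have k1 : 0 < `|k| + 1 by rewrite ltr_wpDl.
have H : `|g x - a * x ^+ 2| <= e / (`|k| + 1) * x ^+ 2.
  by near: x; apply: qg; rewrite divr_gt0.
rewrite -mulrA -mulrBr normrM; apply: le_trans (ler_wpM2l (normr_ge0 k) H) _.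
rewrite mulrA ler_wpM2r ?sqr_ge0// mulrCA ger_pMr//.
by rewrite ler_pdivrMr// mul1r lerDl.
Unshelve. all: by end_near. Qed.

Lemma quadN g a : quad g a -> quad (fun x => - g x) (- a).
Proof.
by move=> /(quadZ (-1)); rewrite mulN1r; under eq_fun do rewrite mulN1r.
Qed.

Lemma quad_near g h c : quad g c -> (\forall x \near (0 : R), g x = h x) ->
  quad h c.
Proof. by move=> qg gh e /qg; apply: filterS2 gh => x ->. Qed.

(** A bound by a multiple of a function that is o(x^2) gives o(x^2); the
    remainder terms in the expansions of exp and log are all treated so. *)
Lemma quad_dom K g h : quad g 0 ->
  (\forall x \near (0 : R), `|h x| <= K * `|g x|) -> quad h 0.
Proof.
move=> /(quadZ K) qg hg e /qg; apply: filterS2 hg => x.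
rewrite mulr0 mul0r !subr0 => h1 h2; apply: le_trans h1 (le_trans _ h2).
by rewrite normrM ler_wpM2r// ler_norm.
Qed.

Lemma quad_bound g c : quad g c ->
  \forall x \near (0 : R), `|g x| <= (`|c| + 1) * x ^+ 2.
Proof.
move=> /(_ 1 ltr01); apply: filterS => x h.
rewrite -[g x](subrK (c * x ^+ 2)) (le_trans (ler_normD _ _))//.
by rewrite normrM (ger0_norm (sqr_ge0 x)) mulrDl addrC lerD2l.
Qed.

Lemma quad_sqr g c : quad g c -> quad (fun x => g x ^+ 2) 0.
Proof.
move=> /quad_bound qg e e0.
have k1 : 0 < `|c| + 1 by rewrite ltr_wpDl.
have d0 : 0 < Num.min 1 (e / (`|c| + 1) ^+ 2).
  by rewrite lt_min ltr01 divr_gt0 ?exprn_gt0.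
apply: filterS2 qg (near0_abs_le d0) => x H X.
rewrite mul0r subr0 normrX.
apply: (@le_trans _ _ (((`|c| + 1) * x ^+ 2) ^+ 2)).
  by rewrite lerXn2r ?nnegrE// mulr_ge0 ?sqr_ge0// ltW.
rewrite exprMn [in X in _ * X]expr2 mulrA ler_wpM2r ?sqr_ge0//.
move: X; rewrite le_min => /andP[X1 X2].
rewrite mulrC -ler_pdivlMr ?exprn_gt0//.
rewrite -(real_normK (num_real x)) expr2 (le_trans _ X2)//.
by rewrite ler_piMl.
Qed.

Lemma quad_cvg0 g c : quad g c -> \forall x \near (0 : R), `|g x| <= 1/4.
Proof.
move=> /quad_bound qg.
have k1 : 0 < `|c| + 1 by rewrite ltr_wpDl.
have d0 : 0 < Num.min 1 ((1/4) / (`|c| + 1)).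
  by rewrite lt_min ltr01 divr_gt0 ?divr_gt0.
apply: filterS2 qg (near0_abs_le d0) => x H X.
move: X; rewrite le_min => /andP[X1]; rewrite ler_pdivlMr// => X2.
rewrite (le_trans H)// (le_trans _ X2)// mulrC ler_wpM2r ?(ltW k1)//.
by rewrite -(real_normK (num_real x)) expr2 ler_piMl.
Qed.

(** For z = f(x) = O(x^2), exp z = 1 + z + O(z^2) and the remainder is O(x^4). *)
Lemma quad_cexp (f : R -> R[i]) c :
  quad (fun x => complex.Re (f x)) c -> quad (fun x => complex.Im (f x)) 0 ->
  quad (fun x => complex.Re (cexp (f x)) - 1) c /\
  quad (fun x => complex.Im (cexp (f x))) 0.
Proof.
rewrite /cexp/=; set a := fun x => complex.Re (f x); set b := fun x => complex.Im (f x).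
move=> qa qb; have qa2 := quad_sqr qa; have qb2 := quad_sqr qb.
have A4 := quad_cvg0 qa; have B4 := quad_cvg0 qb.
have E2 : \forall x \near (0:R), expR (a x) <= 2.
  apply: filterS A4 => x h; have := expR_sub_le (le_trans h (_ : 1/4 <= 1/2)).
  have {}h1 : 1/4 <= 1/2 :> R by lra.
  move=> /(_ h1); rewrite ler_norml; move: h; rewrite ler_norml; nra.
split.
  have q1 : quad (fun x => expR (a x) - 1 - a x) 0.
    apply: (quad_dom (K := 2) qa2); apply: filterS A4 => x h.
    rewrite (ger0_norm (sqr_ge0 _)); apply: expR_sub_le; lra.
  have q2 : quad (fun x => expR (a x) * (cos (b x) - 1)) 0.
    apply: (quad_dom (K := 1) qb2); apply: filterS2 E2 B4 => x E h.
    have := one_sub_cos_le (b x); have := cos_le1 (b x); have := expR_gt0 (a x).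
    move=> p1 p2 p3; rewrite normrM gtr0_norm// distrC ger0_norm ?subr_ge0//.
    rewrite (ger0_norm (sqr_ge0 _)); nra.
  have := quadD (quadD q1 qa) q2; rewrite add0r addr0 => q.
  apply: quad_near q _; near=> x; rewrite -/(a x) -/(b x); ring.
apply: (quad_dom (K := 2) qb); apply: filterS E2 => x E.
rewrite normrM gtr0_norm ?expR_gt0// -/(a x) -/(b x).
have := abs_sin_le (b x); have := expR_gt0 (a x); have := normr_ge0 (sin (b x)).
nra.
Unshelve. all: by end_near. Qed.

(** Continuity and f(0) = 0 make f, near the origin, the branch of the
    logarithm of cexp f that is close to 0, and log(1 + z) = z + O(z^2). *)
Lemma quad_clog (f : R -> R[i]) c : f 0 = 0 ->
  {for 0, continuous (fun x => complex.Re (f x))} ->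
  {for 0, continuous (fun x => complex.Im (f x))} ->
  quad (fun x => complex.Re (cexp (f x)) - 1) c ->
  quad (fun x => complex.Im (cexp (f x))) 0 ->
  quad (fun x => complex.Re (f x)) c /\ quad (fun x => complex.Im (f x)) 0.
Proof.
rewrite /cexp/=; set a := fun x => complex.Re (f x); set b := fun x => complex.Im (f x).
move=> f0 ca cb qp qq.
have a0 : a 0 = 0 by rewrite /a f0.
have b0 : b 0 = 0 by rewrite /b f0.
have A4 : \forall x \near (0:R), `|a x| <= 1/4.
  have /cvgrPdist_le/(_ (1/4)) := ca; rewrite -/(a 0) a0.
  have h : 0 < 1/4 :> R by lra.
  by move=> /(_ h); apply: filterS => x; rewrite sub0r normrN.
have B4 : \forall x \near (0:R), `|b x| <= 1/4.
  have /cvgrPdist_le/(_ (1/4)) := cb; rewrite -/(b 0) b0.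
  have h : 0 < 1/4 :> R by lra.
  by move=> /(_ h); apply: filterS => x; rewrite sub0r normrN.
have EE x : `|a x| <= 1/4 -> `|expR (a x) - 1 - a x| <= 2 * a x ^+ 2.
  move=> h; apply: expR_sub_le; lra.
(* The imaginary part b is at most 2 |sin b|, and exp a >= 1/2. *)
have qb : quad b 0.
  apply: (quad_dom (K := 4) qq); apply: filterS2 A4 B4 => x h1 h2.
  rewrite -/(a x) -/(b x) normrM gtr0_norm ?expR_gt0//.
  have e1 : 1/2 <= expR (a x).
    have := expR_ge1Dx (a x); move: h1; rewrite ler_norml; lra.
  have := abs_sub_sin_le3 (b x).
  have := ler_normD (b x - sin (b x)) (sin (b x)); rewrite subrK.
  have := normr_ge0 (sin (b x)); have := normr_ge0 (b x).
  move: h2; set B := `|b x|; set S := `|sin _| => h2 B0 S0 D C.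
  have B1 : B ^+ 3 <= B.
    by rewrite exprS ler_piMr// expr_le1//; lra.
  have B2 : B <= 2 * S by lra.
  nra.
have qb2 := quad_sqr qb.
have E2 : \forall x \near (0:R), expR (a x) <= 2.
  apply: filterS A4 => x h; have := EE _ h.
  rewrite ler_norml; move: h; rewrite ler_norml; nra.
have q2 : quad (fun x => expR (a x) * (1 - cos (b x))) 0.
  apply: (quad_dom (K := 1) qb2); apply: filterS E2 => x E.
  have := one_sub_cos_le (b x); have := cos_le1 (b x); have := expR_gt0 (a x).
  move=> p1 p2 p3; rewrite normrM gtr0_norm// ger0_norm ?subr_ge0//.
  rewrite (ger0_norm (sqr_ge0 _)); nra.
(* exp a - 1 = (exp a cos b - 1) + exp a (1 - cos b). *)
have qe : quad (fun x => expR (a x) - 1) c.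
  have := quadD qp q2; rewrite addr0 => q.
  apply: quad_near q _; near=> x; rewrite -/(a x) -/(b x); ring.
split=> //.
(* For small a, |a| <= 2 |exp a - 1|, so that exp a - 1 - a = O((exp a - 1)^2). *)
have q3 : quad (fun x => - (expR (a x) - 1 - a x)) 0.
  apply: (quad_dom (K := 8) (quad_sqr qe)); apply: filterS A4 => x h.
  rewrite normrN (ger0_norm (sqr_ge0 _)).
  apply: le_trans (EE _ h) _.
  have := EE _ h; move: h; rewrite !ler_norml => /andP[h1 h2] /andP[h3 h4].
  have [a1|a1] := leP 0 (a x).
    have : a x / 2 <= expR (a x) - 1 by nra.
    nra.
  have : expR (a x) - 1 <= a x / 2 by nra.
  nra.
have := quadD qe q3; rewrite addr0 => q.
by apply: quad_near q _; near=> x; rewrite -/(a x); ring.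
Unshelve. all: by end_near. Qed.

End quadratic_expansion.

(** * Second-order expansions under the integral sign *)

Section expansion_integral.
Context {R : realType}.

Lemma abs_indic_le1 (U : Type) (B : set U) x : `|\1_B x| <= 1 :> R.
Proof. by rewrite indicE ger0_norm// lern1; case: (_ \in _). Qed.

Lemma quad_seq (g : R -> R) c (u : nat -> R) x : quad g c ->
  (forall n, u n != 0) -> u @ \oo --> 0 ->
  g (u n * x) / u n ^+ 2 @[n --> \oo] --> c * x ^+ 2.
Proof.
move=> qg u0 ucvg; apply/cvgrPdist_le => e e0.
have x1 : 0 < x ^+ 2 + 1 by rewrite ltr_wpDl ?sqr_ge0.
have e1 : 0 < e / (x ^+ 2 + 1) by rewrite divr_gt0.
have uxcvg : u n * x @[n --> \oo] --> 0.
  by rewrite -(mul0r x); apply: cvgM => //; exact: cvg_cst.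
have : \forall n \near \oo, `|g (u n * x) - c * (u n * x) ^+ 2| <=
    e / (x ^+ 2 + 1) * (u n * x) ^+ 2 := uxcvg _ (qg _ e1).
apply: filterS => n h.
have un0 : 0 < u n ^+ 2 by rewrite exprn_even_gt0//= u0.
rewrite distrC (_ : _ - _ = (g (u n * x) - c * (u n * x) ^+ 2) / u n ^+ 2); last first.
  by field; exact: u0.
rewrite normrM normfV (gtr0_norm un0) ler_pdivrMr//; apply: le_trans h _.
rewrite exprMn [e / _ * _]mulrA -mulrA [leRHS]mulrC [_ * (_ * x ^+ 2)]mulrC.
rewrite -mulrA ler_wpM2l ?(ltW un0)// mulrCA ger_pMr//.
by rewrite ler_pdivrMr// mul1r lerDl.
Qed.

Lemma quad_of_seq (g : R -> R) c : g 0 = 0 ->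
  (forall u : nat -> R, (forall n, u n != 0) -> u @ \oo --> 0 ->
    g (u n) / u n ^+ 2 @[n --> \oo] --> c) -> quad g c.
Proof.
move=> g0 H e e0.
have /cvgrPdist_le/(_ e e0) : g x / x ^+ 2 @[x --> 0^'] --> c.
  by apply/cvgr_dnbhsP => u []; exact: H.
rewrite near_withinE; apply: filterS => x h.
have [->|x0] := eqVneq x 0; first by rewrite g0 expr0n/= !mulr0 subrr normr0.
have x2 : 0 < x ^+ 2 by rewrite exprn_even_gt0//= x0.
move: (h x0); rewrite distrC (_ : _ - _ = (g x - c * x ^+ 2) / x ^+ 2); last by field.
by rewrite normrM normfV (gtr0_norm x2) ler_pdivrMr.
Qed.

Variables (d : measure_display) (T : measurableType d).
Variable mu : {measure set T -> \bar R}.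

Lemma le_integrable_EFin (f g : T -> R) : measurable_fun setT f ->
  (forall t, `|f t| <= g t) -> mu.-integrable setT (EFin \o g) ->
  mu.-integrable setT (EFin \o f).
Proof.
move=> mf fg; apply: le_integrable => //; first exact/measurable_EFinP.
by move=> t _ /=; rewrite lee_fin (le_trans (fg t))// ler_norm.
Qed.

Lemma integrableZ_EFin (c : R) (f : T -> R) : mu.-integrable setT (EFin \o f) ->
  mu.-integrable setT (EFin \o (fun t => c * f t)).
Proof. exact: (integrableZl measurableT). Qed.

(** Dominated convergence: k(xi X) / xi^2 is dominated by C X^2. *)
Lemma quad_Rintegral (X : T -> R) (k : R -> R) C :
  measurable_fun setT X -> mu.-integrable setT (EFin \o (fun t => X t ^+ 2)) ->
  measurable_fun setT k -> (forall y, `|k y| <= C * y ^+ 2) -> quad k 0 ->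
  quad (fun xi => \int[mu]_t k (xi * X t)) 0.
Proof.
move=> mX iX mk kC qk.
have k0 : k 0 = 0.
  by have := kC 0; rewrite expr0n/= mulr0 normr_le0 => /eqP.
have mkX xi : measurable_fun setT (fun t => k (xi * X t)).
  by apply: measurableT_comp => //; exact: measurable_funM.
have iCX (c : R) : mu.-integrable setT (EFin \o (fun t => c * X t ^+ 2)).
  exact: integrableZ_EFin.
have ikX xi : mu.-integrable setT (EFin \o (fun t => k (xi * X t))).
  apply: le_integrable_EFin (iCX (C * xi ^+ 2)) => // t.
  by rewrite -mulrA -exprMn.
apply: quad_of_seq => [|u u0 ucvg].
  by under eq_Rintegral do rewrite mul0r k0; rewrite /Rintegral integral0.
have un0 n : 0 < u n ^+ 2 by rewrite exprn_even_gt0//= u0.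
have [] := @dominated_convergence _ _ _ mu setT measurableT
  (fun n t => (k (u n * X t) / u n ^+ 2)%:E) (cst 0%E) (EFin \o (fun t => C * X t ^+ 2)) => //.
- move=> n; apply/measurable_EFinP; exact: measurable_funM.
- apply/aeW => t _; apply: cvg_EFin; first by near=> n.
  by have := @quad_seq _ _ u (X t) qk u0 ucvg; rewrite mul0r.
- apply/aeW => t n _ /=; rewrite lee_fin normrM normfV (gtr0_norm (un0 n)).
  by rewrite ler_pdivrMr// -mulrA [_ * u n ^+ 2]mulrC -exprMn.
move=> _ _; rewrite integral0 => /fine_cvgP[_].
apply: cvg_trans; apply: near_eq_cvg; near=> n.
rewrite /= -RintegralZr//.
Unshelve. all: by end_near. Qed.

End expansion_integral.

Arguments quad_seq {R} [g c u] x.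

(** * Characteristic functions and second moments *)

Section moments.
Context {R : realType} (d : measure_display) (T : measurableType d).
Variable P : probability T R.
Variable X : T -> R.
Hypothesis mX : measurable_fun setT X.

Lemma Re_cf xi :
  complex.Re (characteristic_function P X xi) = \int[P]_t cos (xi * X t).
Proof.
by rewrite /=; apply: eq_Rintegral => t _; rewrite expR0 mul1r.
Qed.

Lemma Im_cf xi :
  complex.Im (characteristic_function P X xi) = \int[P]_t sin (xi * X t).
Proof.
by rewrite /=; apply: eq_Rintegral => t _; rewrite expR0 mul1r.
Qed.

Lemma measurable_cosZ xi : measurable_fun setT (fun t => cos (xi * X t)).
Proof.
apply: measurableT_comp; last exact: measurable_funM.
by apply: continuous_measurable_fun; exact: continuous_cos.
Qed.

Lemma measurable_sinZ xi : measurable_fun setT (fun t => sin (xi * X t)).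
Proof.
apply: measurableT_comp; last exact: measurable_funM.
by apply: continuous_measurable_fun; exact: continuous_sin.
Qed.

Lemma integrable_cst_prob (c : R) : P.-integrable setT (EFin \o cst c).
Proof. exact: finite_measure_integrable_cst. Qed.

Lemma integrable_indic_prob (E : set T) : measurable E ->
  P.-integrable setT (EFin \o (\1_E : T -> R)).
Proof.
move=> mE; apply: le_integrable_EFin (integrable_cst_prob 1) => [|t].
  exact/measurable_indic/mE.
exact: abs_indic_le1.
Qed.

Lemma Rintegral_cst_prob (c : R) : \int[P]_t c = c.
Proof. by rewrite Rintegral_cst// [X in fine X]probability_setT mulr1. Qed.

Lemma integrable_cosZ xi : P.-integrable setT (EFin \o (fun t => cos (xi * X t))).
Proof.
apply: le_integrable_EFin (integrable_cst_prob 1) => [|t]; first exact: measurable_cosZ.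
exact: cos_max.
Qed.

Lemma integrable_sinZ xi : P.-integrable setT (EFin \o (fun t => sin (xi * X t))).
Proof.
apply: le_integrable_EFin (integrable_cst_prob 1) => [|t]; first exact: measurable_sinZ.
exact: sin_max.
Qed.

Lemma integrable_of_sqr : P.-integrable setT (EFin \o (fun t => X t ^+ 2)) ->
  P.-integrable setT (EFin \o X).
Proof.
move=> iX; have := integrableD measurableT (integrable_cst_prob 1) iX.
apply: (@le_integrable_EFin _ _ _ _ X (fun t => 1 + X t ^+ 2)) => // t.
rewrite -(real_normK (num_real (X t))); have := normr_ge0 (X t); nra.
Qed.

Lemma quad_cos : quad (fun y : R => cos y - 1 + y ^+ 2 / 2) 0.
Proof.
move=> e e0; have e1 : 0 < Num.min 1 e by rewrite lt_min ltr01.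
apply: filterS (near0_abs_le e1) => x.
rewrite le_min mul0r subr0 => /andP[x1 xe].
rewrite ger0_norm; last by have := one_sub_cos_le x; lra.
apply: (@le_trans _ _ (x ^+ 4 / 24)); first by have := one_sub_cos_ge x; lra.
rewrite (_ : x ^+ 4 / 24 = (x ^+ 2 / 24) * x ^+ 2); last by ring.
rewrite ler_wpM2r ?sqr_ge0// -(real_normK (num_real x)).
have := normr_ge0 x; nra.
Qed.

Lemma quad_sin : quad (fun y : R => sin y - y) 0.
Proof.
move=> e e0; apply: filterS (near0_abs_le e0) => x xe.
rewrite mul0r subr0 distrC; apply: le_trans (abs_sub_sin_le3 x) _.
rewrite exprS mulrAC -(real_normK (num_real x)) ler_wpM2r ?exprn_ge0//.
have := normr_ge0 x; nra.
Qed.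

(** Here cos y - 1 + y^2/2 and sin y - y are O(y^2) everywhere and o(y^2) at 0,
    so that both expansions can be taken under the expectation. *)
Lemma quad_cf_of_moments s :
  (\int[P]_t (X t ^+ 2)%:E = s%:E)%E -> (\int[P]_t (X t)%:E = 0)%E ->
  quad (fun xi => complex.Re (characteristic_function P X xi) - 1) (- (s / 2)) /\
  quad (fun xi => complex.Im (characteristic_function P X xi)) 0.
Proof.
move=> X2 X1.
have iX2 : P.-integrable setT (EFin \o (fun t => X t ^+ 2)).
  apply/integrableP; split.
    by apply/measurable_EFinP; exact: measurable_funX.
  under eq_integral do rewrite /= ger0_norm ?sqr_ge0//.
  by rewrite X2 ltry.
have iX := integrable_of_sqr iX2.
split.
  have q1 := @quad_Rintegral _ _ _ P X _ (1/2) mX iX2 _ _ quad_cos.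
  have {}q1 : quad (fun xi : R => \int[P]_t (cos (xi * X t) - 1 + (xi * X t) ^+ 2 / 2)) 0.
    apply: q1.
      apply: measurable_funD; last by apply: measurable_funM => //; exact: measurable_funX.
      apply: measurable_funB => //.
      by apply: continuous_measurable_fun; exact: continuous_cos.
    move=> y; rewrite ger0_norm; last by have := one_sub_cos_le y; lra.
    have := cos_le1 y; lra.
  have q2 : quad (fun xi : R => - (s / 2) * xi ^+ 2) (- (s / 2)).
    by move=> e e0; near=> x; rewrite subrr normr0 mulr_ge0 ?sqr_ge0// ltW.
  have := quadD q1 q2; rewrite add0r => q; apply: quad_near q _; near=> xi.
  rewrite Re_cf RintegralD//; first last.
  - have := integrableZ_EFin (xi ^+ 2 / 2) iX2.
    by congr (_.-integrable _ (_ \o _)); apply/funext => t; field.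
  - exact: (integrableB measurableT (integrable_cosZ xi) (integrable_cst_prob 1)).
  rewrite RintegralB//; [|exact: integrable_cosZ|exact: integrable_cst_prob].
  have -> : \int[P]_t ((xi * X t) ^+ 2 / 2) = (xi ^+ 2 / 2) * s.
    rewrite -[s]/(fine s%:E) -X2 -RintegralZl//.
    by apply: eq_Rintegral => t _; field.
  by rewrite Rintegral_cst_prob; field.
have q1 := @quad_Rintegral _ _ _ P X _ 2 mX iX2 _ _ quad_sin.
have {}q1 : quad (fun xi : R => \int[P]_t (sin (xi * X t) - xi * X t)) 0.
  apply: q1; last by move=> y; rewrite distrC; exact: abs_sub_sin_le2.
  apply: measurable_funB => //.
  by apply: continuous_measurable_fun; exact: continuous_sin.
apply: quad_near q1 _; near=> xi.
rewrite RintegralB//; [|exact: integrable_sinZ|exact: integrableZ_EFin].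
by rewrite RintegralZl// [\int[P]_t X t]/Rintegral X1 mulr0 subr0 Im_cf.
Unshelve. all: by end_near. Qed.

(** Fatou's lemma, applied to 2 (1 - cos(uX)) / u^2 -> X^2 as u = 1/(n+1) -> 0,
    bounds the second moment by s, so that it is finite. The converse inequality
    is 2 (1 - cos y) <= y^2. *)
Lemma second_moment_of_quad s :
  quad (fun xi => complex.Re (characteristic_function P X xi) - 1) (- (s / 2)) ->
  (\int[P]_t (X t ^+ 2)%:E = s%:E)%E.
Proof.
move=> q; pose u (n : nat) : R := n.+1%:R^-1.
have u0 n : u n != 0 by rewrite invr_eq0 pnatr_eq0.
have ucvg : u @ \oo --> 0 by exact: cvg_harmonic.
have un0 n : 0 < u n ^+ 2 by rewrite exprn_even_gt0//= u0.
pose g n t : R := 2 / u n ^+ 2 * (1 - cos (u n * X t)).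
have mg n : measurable_fun setT (g n).
  by apply: measurable_funM => //; apply: measurable_funB => //; exact: measurable_cosZ.
have g0 n t : 0 <= g n t.
  by rewrite mulr_ge0 ?subr_ge0 ?cos_le1// divr_ge0 ?ltW.
have gX n t : g n t <= X t ^+ 2.
  rewrite /g mulrAC ler_pdivrMr// -mulrC -exprMn.
  by have := one_sub_cos_le (u n * X t); rewrite [X t * _]mulrC; lra.
have intg n : (\int[P]_t (g n t)%:E =
    (2 * ((1 - complex.Re (characteristic_function P X (u n))) / u n ^+ 2))%:E)%E.
  have i1 : P.-integrable setT (EFin \o (fun t => 1 - cos (u n * X t))).
    exact: (integrableB measurableT (integrable_cst_prob 1) (integrable_cosZ _)).
  rewrite -[LHS]fineK; last first.
    have := integrableZl measurableT (2 / u n ^+ 2) i1; exact: integrable_fin_num.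
  congr EFin; rewrite -/(Rintegral _ _ _) RintegralZl//.
  rewrite RintegralB//; [|exact: integrable_cst_prob|exact: integrable_cosZ].
  by rewrite Rintegral_cst_prob Re_cf; field; exact: u0.
have cvg1 : (\int[P]_t (g n t)%:E)%E @[n --> \oo] --> s%:E.
  under eq_fun do rewrite intg.
  apply: cvg_EFin; first by near=> n.
  have := cvgM (cvg_cst (-2 : R)) (quad_seq 1 q u0 ucvg).
  rewrite (_ : -2 * _ = s); last by field.
  move=> /(_ _ _); apply: cvg_trans.
  apply: near_eq_cvg; near=> n; rewrite /= mulr1; field; exact: u0.
apply/eqP; rewrite eq_le; apply/andP; split.
  have mgE n : measurable_fun setT (fun t => (g n t)%:E) by exact/measurable_EFinP.
  have := @fatou _ _ _ P setT measurableT (fun n t => (g n t)%:E) mgE.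
  move=> /(_ (fun n t _ => g0 n t)).
  rewrite (cvg_limn_einf_sup cvg1).1; apply: le_trans.
  rewrite (_ : \int[P]_t _ = \int[P]_t limn_einf (fun n => (g n t)%:E))%E//.
  apply: eq_integral => t _; 
  suff /cvg_limn_einf_sup[->] : (g n t)%:E @[n --> \oo] --> (X t ^+ 2)%:E by [].
  apply: cvg_EFin; first by near=> n.
  have qc : quad (fun y : R => 1 - cos y) (1 / 2).
    have q2 : quad (fun y : R => (1 / 2) * y ^+ 2) (1 / 2).
      by move=> e e0; near=> x; rewrite subrr normr0 mulr_ge0 ?sqr_ge0// ltW.
    have := quadD (quadN quad_cos) q2; rewrite oppr0 add0r => h.
    by apply: quad_near h _; near=> x; field.
  have := cvgM (cvg_cst (2 : R)) (quad_seq (X t) qc u0 ucvg).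
  rewrite (_ : 2 * _ = X t ^+ 2); last by field.
  move=> /(_ _ _); apply: cvg_trans.
  by apply: near_eq_cvg; near=> n; rewrite /= /g; field; exact: u0.
apply: (cvge_le _ cvg1); near=> n.
apply: ge0_le_integral => //.
- by move=> t _; rewrite lee_fin.
- exact/measurable_EFinP.
- by apply/measurable_EFinP; exact: measurable_funX.
- by move=> t _; rewrite lee_fin.
Unshelve. all: by end_near. Qed.

(** The imaginary part of the characteristic function is xi E[X] + o(xi^2), which
    is o(xi^2) only if E[X] = 0. *)
Lemma mean_of_quad : P.-integrable setT (EFin \o (fun t => X t ^+ 2)) ->
  quad (fun xi => complex.Im (characteristic_function P X xi)) 0 ->
  (\int[P]_t (X t)%:E = 0)%E.
Proof.
move=> iX2 q; have iX := integrable_of_sqr iX2.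
have q1 := @quad_Rintegral _ _ _ P X _ 2 mX iX2 _ _ quad_sin.
have {}q1 : quad (fun xi : R => \int[P]_t (sin (xi * X t) - xi * X t)) 0.
  apply: q1; last by move=> y; rewrite distrC; exact: abs_sub_sin_le2.
  apply: measurable_funB => //.
  by apply: continuous_measurable_fun; exact: continuous_sin.
set m := \int[P]_t X t.
have qm : quad (fun xi => xi * m) 0.
  have := quadD q (quadN q1); rewrite oppr0 addr0 => h.
  apply: quad_near h _; near=> xi.
  rewrite RintegralB//; [|exact: integrable_sinZ|exact: integrableZ_EFin].
  by rewrite RintegralZl// Im_cf opprB addrC subrK.
have m0 : m = 0.
  pose u (n : nat) : R := n.+1%:R^-1.
  have u0 n : u n != 0 by rewrite invr_eq0 pnatr_eq0.
  have ucvg : u @ \oo --> 0 by exact: cvg_harmonic.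
  have := quad_seq 1 qm u0 ucvg; rewrite mul0r => h.
  have : u n * (u n * 1 * m / u n ^+ 2) @[n --> \oo] --> (0 * 0 : R) by exact: cvgM.
  under eq_fun => n.
    rewrite (_ : _ * _ = m); last by field; exact: u0.
    over.
  rewrite mulr0 => /(cvg_unique _ (cvg_cst m)); exact.
by rewrite -[LHS]fineK ?integrable_fin_num// -/(Rintegral _ _ _) -/m m0.
Unshelve. all: by end_near. Qed.

End moments.

(** * Lévy white noise on test functions *)

Section expansion_composition.
Context {R : realType} (d : measure_display) (T : measurableType d).
Variable mu : {measure set T -> \bar R}.

(** As psi is bounded, xi psi is uniformly small for small xi, so that the
    expansion of f at the origin can be integrated. *)
Lemma quad_integral_comp (f : R -> R) c (psi : T -> R) M :
  quad f c -> (forall t, `|psi t| <= M) ->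
  mu.-integrable setT (EFin \o (fun t => psi t ^+ 2)) ->
  (forall xi, mu.-integrable setT (EFin \o (fun t => f (xi * psi t)))) ->
  quad (fun xi => \int[mu]_t f (xi * psi t)) (c * \int[mu]_t (psi t ^+ 2)).
Proof.
move=> qf psiM i2 ifpsi e e0; set S := \int[mu]_t _.
have S0 : 0 <= S by apply: Rintegral_ge0 => t _; exact: sqr_ge0.
(* S and M may be 0, hence the divisors S + 1 and |M| + 1. *)
have S1 : 0 < S + 1 by rewrite ltr_wpDl.
have e1 : 0 < e / (S + 1) by rewrite divr_gt0.
have /nbhs_ballP[r /= r0 rf] := qf _ e1.
have M1 : 0 < `|M| + 1 by rewrite ltr_wpDl.
have r1 : 0 < r / 2 / (`|M| + 1) by rewrite !divr_gt0.
apply: filterS (near0_abs_le r1) => xi; rewrite ler_pdivlMr// => xir.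
have bd t : `|f (xi * psi t) - c * (xi * psi t) ^+ 2| <= e / (S + 1) * (xi * psi t) ^+ 2.
  apply: rf; rewrite /ball/= sub0r normrN normrM.
  apply: le_lt_trans (_ : r / 2 < r); last by rewrite ltr_pdivrMr// ltr_pMr// ltr1n.
  apply: le_trans xir; rewrite ler_wpM2l//.
  by apply: le_trans (psiM t) _; rewrite (le_trans (ler_norm _))// lerDl.
have i3 a : mu.-integrable setT (EFin \o (fun t => a * (xi * psi t) ^+ 2)).
  have := integrableZ_EFin (a * xi ^+ 2) i2.
  by congr (_.-integrable _ (_ \o _)); apply/funext => t; ring.
have i3E a : \int[mu]_t (a * (xi * psi t) ^+ 2) = a * xi ^+ 2 * S.
  by rewrite -RintegralZl//; apply: eq_Rintegral => t _; rewrite exprMn mulrA.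
have i4 : mu.-integrable setT (EFin \o (fun t => f (xi * psi t) - c * (xi * psi t) ^+ 2)).
  exact: (integrableB measurableT (ifpsi xi) (i3 c)).
rewrite (_ : _ - _ = \int[mu]_t (f (xi * psi t) - c * (xi * psi t) ^+ 2)); last first.
  by rewrite RintegralB// i3E mulrAC.
apply: le_trans (le_normr_Rintegral measurableT i4) _.
apply: (@le_trans _ _ (\int[mu]_t (e / (S + 1) * (xi * psi t) ^+ 2))).
  apply: le_Rintegral => //; exact: integrable_norm.
rewrite i3E mulrAC ler_wpM2r ?sqr_ge0// mulrAC ler_pdivrMr// ler_pM2l//.
by rewrite lerDl.
Qed.

End expansion_composition.

Section schwartz_integrability.
Context {R : realType}.
Local Notation leb := (@lebesgue_measure R).
Implicit Types psi : schwartz R.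

Lemma schwartz_continuous psi : continuous psi.
Proof.
have [spsi _] := schwartzP psi => x.
by apply: differentiable_continuous; apply/derivable1_diffP; exact: (spsi 0%N x).
Qed.

Lemma schwartz_measurable psi : measurable_fun setT psi.
Proof. by apply: continuous_measurable_fun; exact: schwartz_continuous. Qed.

Lemma schwartz_bounded psi : exists C, forall x, `|psi x| <= C.
Proof.
have [_ /(_ 0%N 0%N)[C HC]] := schwartzP psi; exists C => x.
by have := HC x; rewrite expr0 mul1r.
Qed.

Lemma integrable_oneDsqrV : leb.-integrable setT (EFin \o (fun x : R => (oneDsqr x)^-1)).
Proof.
have m1 : measurable_fun setT (fun x : R => (oneDsqr x)^-1).
  by apply: continuous_measurable_fun; exact: continuous_oneDsqrV.
apply/integrableP; split; first exact/measurable_EFinP.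
have g0 (x : R) : 0 <= (oneDsqr x)^-1 by rewrite invr_ge0.
under eq_integral do rewrite /= ger0_norm//.
rewrite ge0_symfun_integralT//; last 2 first.
- exact: continuous_oneDsqrV.
- by move=> x /=; rewrite /oneDsqr sqrrN.
rewrite -set_itvcy integral0y_oneDsqr -EFinM; exact: ltry.
Qed.

(** Both |psi| and x^2 |psi| are bounded, so psi^2 <= |psi| sup |psi| is at most a
    multiple of 1/(1 + x^2). *)
Lemma schwartz_sqr_integrable psi :
  leb.-integrable setT (EFin \o (fun x => psi x ^+ 2)).
Proof.
have [_ b] := schwartzP psi.
have [C HC] := b 0%N 0%N; have [D HD] := b 2%N 0%N.
have := integrableZ_EFin (C * (C + D)) integrable_oneDsqrV.
apply: le_integrable_EFin; first by apply: measurable_funX; exact: schwartz_measurable.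
move=> x; have := HC x; have := HD x; rewrite expr0 mul1r derive1n0 => hD hC.
have C0 : 0 <= C by exact: le_trans hC.
rewrite normrX expr2 -mulrA ler_pM// ler_pdivlMr// mulrDr mulr1 lerD//.
by rewrite mulrC -[X in X * _](ger0_norm (sqr_ge0 x)) -normrM.
Qed.

End schwartz_integrability.

Section convergence_in_probability.
Context {R : realType} (d : measure_display) (T : measurableType d).
Variable P : probability T R.

(** |h(Y_m) - h(X)| is at most 2, and small unless |Y_m - X| is large, which has
    small probability. *)
Lemma cvg_probability_integral (Y : nat -> T -> R) (X : T -> R) (h : R -> R) k :
  (forall m, measurable_fun setT (Y m)) -> measurable_fun setT X ->
  (forall e, 0 < e -> P [set t | e <= `|Y m t - X t|] @[m --> \oo] --> 0%E) ->
  measurable_fun setT h -> (forall a, `|h a| <= 1) ->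
  (forall a b, `|h a - h b| <= k * `|a - b|) ->
  \int[P]_t h (Y m t) @[m --> \oo] --> \int[P]_t h (X t).
Proof.
move=> mY mX YX mh h1 hk; apply/cvgrPdist_le => e e0.
have k1 : 0 < 2 * (`|k| + 1) by rewrite mulr_gt0// ltr_wpDl.
have dl0 : 0 < e / (2 * (`|k| + 1)) by rewrite divr_gt0.
set dl := e / _ in dl0.
have ih (Z : T -> R) : measurable_fun setT Z -> P.-integrable setT (EFin \o (fun t => h (Z t))).
  move=> mZ; apply: le_integrable_EFin (integrable_cst_prob P 1) => //.
  exact: measurableT_comp.
have mE m : measurable [set t | dl <= `|Y m t - X t|].
  rewrite -[X in measurable X]setTI; apply: measurable_fun_le => //.
  by apply: measurableT_comp => //; exact: measurable_funB.
have /fine_cvgP[Pfin /cvgrPdist_le/(_ (e / 4))] := YX _ dl0.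
have e4 : 0 < e / 4 by rewrite divr_gt0.
move=> /(_ e4); apply: filterS => m /=; rewrite sub0r normrN ger0_norm ?fine_ge0// => Pm.
set E := [set t | dl <= `|Y m t - X t|] in Pm.
have iE1 : P.-integrable setT (EFin \o (\1_E : T -> R)).
  by apply: integrable_indic_prob; exact: mE.
have iE : P.-integrable setT (EFin \o (fun t => 2 * (\1_E t : R))).
  apply: integrableZ_EFin; exact: iE1.
have iB : P.-integrable setT (EFin \o (fun t => h (X t) - h (Y m t))).
  exact: (integrableB measurableT (ih _ mX) (ih _ (mY m))).
rewrite -RintegralB//; [|exact: ih|exact: ih].
apply: le_trans (le_normr_Rintegral measurableT iB) _.
apply: (@le_trans _ _ (\int[P]_t (`|k| * dl + 2 * (\1_E t : R)))).
  apply: le_Rintegral => //.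
  - exact: integrable_norm.
  - exact: (integrableD measurableT (integrable_cst_prob P _) iE).
  - move=> t _; rewrite indicE; have [tE|tE] := boolP (t \in E).
      apply: (@le_trans _ _ 2); last by rewrite mulr1 lerDr mulr_ge0// ltW.
      by apply: le_trans (ler_normB _ _) _; rewrite -[leRHS]/(1 + 1) lerD.
    rewrite mulr0 addr0; apply: le_trans (hk _ _) _.
    apply: (@le_trans _ _ (`|k| * `|X t - Y m t|)); first by rewrite ler_wpM2r// ler_norm.
    rewrite ler_wpM2l// distrC ltW// ltNge; apply/negP => h'.
    by move: tE; rewrite notin_setE; exact.
rewrite RintegralD//; [|exact: integrable_cst_prob].
rewrite Rintegral_cst_prob RintegralZl//.
have -> : \int[P]_t (\1_E t : R) = fine (P E).
  by rewrite /Rintegral integral_indic ?setIT//; exact: mE.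
have : `|k| * dl <= e / 2.
  rewrite /dl mulrCA ler_pM2l// invfM mulrCA ger_pMr ?invr_gt0//.
  by rewrite ler_pdivrMr ?mul1r ?lerDl// ltr_wpDl.
lra.
Qed.

End convergence_in_probability.

Section extended_value.
Context {R : realType}.
Local Notation leb := (@lebesgue_measure R).

(** Dominated convergence: as g(0) = 0, the integrands vanish outside [-K, K],
    where they are bounded by the maximum of |g| on [-|xi| C, |xi| C]. *)
Lemma cvg_integral_rect (g : R -> R) (xi C K : R) (phi_ : nat -> schwartz R) :
  continuous g -> g 0 = 0 ->
  (forall m x, `|phi_ m x| <= C) -> (forall m x, K < `|x| -> phi_ m x = 0) ->
  {ae leb, forall x, phi_ m x @[m --> \oo] --> rect01 x} ->
  \int[leb]_x g (xi * phi_ m x) @[m --> \oo] --> g xi.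
Proof.
move=> cg g0 phiC phiK phicvg.
have C0 : 0 <= C by apply: le_trans (phiC 0%N 0).
have mg : measurable_fun setT g by exact: continuous_measurable_fun.
have [M M0 gM] : exists2 M, 0 <= M & forall y, `|y| <= `|xi| * C -> `|g y| <= M.
  have ab : - (`|xi| * C) <= `|xi| * C by rewrite ge0_cp// mulr_ge0.
  have [c _ cmax] := @EVT_max R (fun y => `|g y|) _ _ ab
    (continuous_subspaceT (fun y => continuous_comp (cg y) (@norm_continuous _ _ _))).
  by exists `|g c| => // y; rewrite ler_norml => yab; apply: cmax; rewrite in_itv.
have mphi m : measurable_fun setT (fun x => g (xi * phi_ m x)).
  by apply: measurableT_comp => //; apply: measurable_funM => //; exact: schwartz_measurable.
have [] := @dominated_convergence _ _ _ leb setT measurableT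
  (fun m x => (g (xi * phi_ m x))%:E) (fun x => (g (xi * rect01 x))%:E)
  (EFin \o (fun x => M * (\1_`[- K, K] x : R))) => //.
- by move=> m; apply/measurable_EFinP; exact: mphi.
- apply/measurable_EFinP; apply: measurableT_comp => //.
  by apply: measurable_funM => //; exact: measurable_indic.
- have [N [mN N0 sN]] := phicvg; exists N; split=> // x nx; apply: sN => hx; apply: nx => _.
  apply: cvg_EFin; first by near=> m.
  apply: (@continuous_cvg _ _ _ _ _ (fun m => xi * phi_ m x) g); first exact: cg.
  by apply: cvgM => //; exact: cvg_cst.
- by apply: integrableZ_EFin; exact: integrable_indic_itv.
- apply/aeW => x m _ /=; rewrite lee_fin indicE mem_setE in_itv/= -ler_norml.
  have [xK|xK] := leP `|x| K; last by rewrite phiK// mulr0 g0 normr0 mulr0.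
  by rewrite mulr1; apply: gM; rewrite normrM ler_wpM2l.
move=> _ _; rewrite (_ : (\int[leb]_x _)%E = (g xi)%:E); first by case/fine_cvgP.
rewrite (_ : (fun x => _) = EFin \o (fun x => g xi * (\1_`]0, 1] x : R))); last first.
  apply/funext => x /=; rewrite /rect01 indicE.
  by case: (x \in _); rewrite ?mulr1// !mulr0 g0.
rewrite -[LHS]fineK; last first.
  apply: integrable_fin_num => //; apply: integrableZ_EFin; exact: integrable_indic_itv.
congr EFin; rewrite -/(Rintegral _ _ _) RintegralZl//; last exact: integrable_indic_itv.
have := @lebesgue_measure_itv R `]0, 1]; rewrite /= lte_fin ltr01 oppr0 adde0 => leb01.
by rewrite /Rintegral integral_indic// setIT [X in fine X]leb01 mulr1.
Unshelve. all: by end_near. Qed.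

Variables (d : measure_display) (T : measurableType d) (P : probability T R).

(** Both sides are limits along the test functions that approximate the
    indicator function of ]0, 1]. *)
Lemma extended_value_cf (w : generalized_process T R) (f : R -> R[i]) (X : {RV P >-> R}) :
  levy_white_noise P w f -> extended_value P w rect01 X ->
  forall xi, characteristic_function P X xi = cexp (f xi).
Proof.
move=> [[d0 [T0 [P0 [X0 [_ [cRe cIm] f0 _]]]]] _ _ cfw] [phi_ [[C phiC] [K phiK] phirect phiX]] xi.
have mX : measurable_fun setT X by [].
have mw m : measurable_fun setT (fun t => w t (phi_ m)) by exact: process_measurable.
have cos_cvg : \int[P]_t cos (xi * w t (phi_ m)) @[m --> \oo] --> \int[P]_t cos (xi * X t).
  apply: (@cvg_probability_integral _ _ _ P _ _ (fun a => cos (xi * a)) `|xi|) => //.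
  - by apply: (@measurable_cosZ _ _ _ (fun a : R => a)).
  - by move=> a; exact: cos_max.
  - by move=> a b; rewrite -normrM mulrBr; exact: abs_cos_sub_le.
have sin_cvg : \int[P]_t sin (xi * w t (phi_ m)) @[m --> \oo] --> \int[P]_t sin (xi * X t).
  apply: (@cvg_probability_integral _ _ _ P _ _ (fun a => sin (xi * a)) `|xi|) => //.
  - by apply: (@measurable_sinZ _ _ _ (fun a : R => a)).
  - by move=> a; exact: sin_max.
  - by move=> a b; rewrite -normrM mulrBr; exact: abs_sin_sub_le.
have Recvg := cvg_integral_rect (xi := xi) cRe (congr1 (@complex.Re R) f0) phiC phiK phirect.
have Imcvg := cvg_integral_rect (xi := xi) cIm (congr1 (@complex.Im R) f0) phiC phiK phirect.
have expcvg := cvg_comp _ _ Recvg (@continuous_expR R _).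
apply/eqP; rewrite eq_complex; apply/andP; split; apply/eqP.
  rewrite Re_cf; apply: (cvg_unique (@Rhausdorff R) cos_cvg).
  have := cvgM expcvg (cvg_comp _ _ Imcvg (@continuous_cos R _)).
  move=> /(_ _); apply: cvg_trans; apply: near_eq_cvg; near=> m.
  by rewrite -Re_cf (cfw _ _).2.
rewrite Im_cf; apply: (cvg_unique (@Rhausdorff R) sin_cvg).
have := cvgM expcvg (cvg_comp _ _ Imcvg (@continuous_sin R _)).
move=> /(_ _); apply: cvg_trans; apply: near_eq_cvg; near=> m.
by rewrite -Im_cf (cfw _ _).2.
Unshelve. all: by end_near. Qed.

End extended_value.

(** * Second moments of the white noise *)

Section white_noise_moments.
Context {R : realType}.
Local Notation leb := (@lebesgue_measure R).

Lemma sqr_moment_of_variance (d : measure_display) (T : measurableType d)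
    (P : probability T R) (X : {RV P >-> R}) :
  ('E_P[X] = 0)%E -> ('V_P[X] < +oo)%E ->
  exists s, (\int[P]_t (X t ^+ 2)%:E = s%:E)%E.
Proof.
move=> X0 VX; exists (fine 'V_P[X]%E).
have VE : ('V_P[X] = \int[P]_t (X t ^+ 2)%:E)%E.
  rewrite /variance unlock X0 unlock.
  by apply: eq_integral => t _; rewrite !fctE/= subr0 expr2.
by rewrite -VE fineK// ge0_fin_numE// variance_ge0.
Qed.

Variables (d : measure_display) (T : measurableType d) (P : probability T R).
Variables (w : generalized_process T R) (f : R -> R[i]) (X : {RV P >-> R}).
Hypothesis Hw : levy_white_noise P w f.
Hypothesis HX : extended_value P w rect01 X.
Variable s : R.
Hypothesis X1 : (\int[P]_t (X t)%:E = 0)%E.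
Hypothesis X2 : (\int[P]_t (X t ^+ 2)%:E = s%:E)%E.

(** f is the logarithm of the characteristic function of X, which has mean 0 and
    variance s. *)
Lemma levy_exponent_quad :
  quad (fun xi => complex.Re (f xi)) (- (s / 2)) /\
  quad (fun xi => complex.Im (f xi)) 0.
Proof.
have [[d0 [T0 [P0 [X0 [_ [cRe cIm] f0 _]]]]] _ _ _] := Hw.
have mX : measurable_fun setT X by [].
have [q1 q2] := quad_cf_of_moments mX X2 X1.
have cfE := extended_value_cf Hw HX.
apply: quad_clog => //; [exact: cRe|exact: cIm| |].
- by apply: quad_near q1 _; near=> xi; rewrite cfE.
- by apply: quad_near q2 _; near=> xi; rewrite cfE.
Unshelve. all: by end_near. Qed.

(** The characteristic function of <psi, w> is the exponential of the integral
    of f(xi psi) = - s xi^2 psi^2 / 2 + o(xi^2). *)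
Lemma white_noise_second_moment (psi : schwartz R) :
  (\int[P]_t (w t psi ^+ 2)%:E = (s * \int[leb]_x (psi x ^+ 2))%:E)%E.
Proof.
have [_ _ _ cfw] := Hw; have [q1 q2] := levy_exponent_quad.
have [M psiM] := schwartz_bounded psi.
have i2 := schwartz_sqr_integrable psi.
have p1 := @quad_integral_comp R _ _ leb _ _ _ _ q1 psiM i2 (fun xi => (cfw psi xi).1.1).
have p2 := @quad_integral_comp R _ _ leb _ _ _ _ q2 psiM i2 (fun xi => (cfw psi xi).1.2).
rewrite mul0r in p2.
have [r1 _] := @quad_cexp _ (fun xi => cintegral leb (fun r => f (xi * psi r))) _ p1 p2.
have mw : measurable_fun setT (fun t => w t psi) by exact: process_measurable.
apply: (second_moment_of_quad mw).
have -> : - (s * \int[leb]_x (psi x ^+ 2) / 2) = - (s / 2) * \int[leb]_x (psi x ^+ 2) by field.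
by apply: quad_near r1 _; near=> xi; rewrite (cfw psi xi).2.
Unshelve. all: by end_near. Qed.

Lemma amplitude_moments (d' : measure_display) (T' : measurableType d')
    (P' : probability T' R) (A : {RV P' >-> R}) (c : R) :
  has_levy_exponent A (fun xi => c%:C%C * f xi) ->
  (\int[P']_t (A t)%:E = 0)%E /\ (\int[P']_t (A t ^+ 2)%:E = (c * s)%:E)%E.
Proof.
move=> [_ _ _ cfA]; have [q1 q2] := levy_exponent_quad.
have ReZ xi : complex.Re (c%:C%C * f xi) = c * complex.Re (f xi).
  by case: (f xi) => a b /=; rewrite mul0r subr0.
have ImZ xi : complex.Im (c%:C%C * f xi) = c * complex.Im (f xi).
  by case: (f xi) => a b /=; rewrite mul0r addr0.
have p1 := quadZ c q1; have p2 := quadZ c q2; rewrite mulr0 in p2.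
have [r1 r2] : quad (fun x => complex.Re (cexp (c%:C%C * f x)) - 1) (c * - (s / 2)) /\
    quad (fun x => complex.Im (cexp (c%:C%C * f x))) 0.
  apply: quad_cexp.
  - by apply: quad_near p1 _; near=> xi; rewrite ReZ.
  - by apply: quad_near p2 _; near=> xi; rewrite ImZ.
have mA : measurable_fun setT A by [].
have A2 : (\int[P']_t (A t ^+ 2)%:E = (c * s)%:E)%E.
  apply: (second_moment_of_quad mA).
  have -> : - (c * s / 2) = c * - (s / 2) by field.
  by apply: quad_near r1 _; near=> xi; rewrite cfA.
split=> //; apply: mean_of_quad => //.
  apply/integrableP; split.
    by apply/measurable_EFinP; exact: measurable_funX.
  by under eq_integral do rewrite /= ger0_norm ?sqr_ge0//; rewrite A2 ltry.
by apply: quad_near r2 _; near=> xi; rewrite cfA.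
Unshelve. all: by end_near. Qed.

End white_noise_moments.

(** * Independence and expectations *)

Section zero_weight.
Context {R : realType} (d : measure_display) (T : measurableType d).
Variable mu : {measure set T -> \bar R}.

Import HBNNSimple.

Lemma integrable_mul_bounded (f b : T -> R) M : measurable_fun setT b ->
  (forall t, `|b t| <= M) -> mu.-integrable setT (EFin \o f) ->
  mu.-integrable setT (EFin \o (fun t => f t * b t)).
Proof.
move=> mb bM fi; have fi' := integrableZ_EFin M (integrable_norm fi).
have mf : measurable_fun setT f by exact/measurable_EFinP/(measurable_int _ fi).
apply: (le_integrable_EFin _ _ fi') => [|t]; first exact: measurable_funM.
by rewrite normrM mulrC ler_wpM2r.
Qed.

Let ge0_case (Z Y : T -> R) (h : R -> R) :
  measurable_fun setT Y -> measurable_fun setT h -> (forall y, 0 <= h y) ->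
  mu.-integrable setT (EFin \o Z) ->
  (forall B, measurable B -> (\int[mu]_t (Z t * \1_B (Y t))%:E = 0)%E) ->
  mu.-integrable setT (EFin \o (fun t => Z t * h (Y t))) ->
  (\int[mu]_t (Z t * h (Y t))%:E = 0)%E.
Proof.
move=> mY mh h0 Zi Z0 Zhi.
have mhE : measurable_fun setT (EFin \o h) by exact/measurable_EFinP.
have [g [gnd gh]] := approximation measurableT mhE (fun y _ => h0 y).
have mZ : measurable_fun setT Z by exact/measurable_EFinP/(measurable_int _ Zi).
have gcvg y : g n y @[n --> \oo] --> h y by have /fine_cvgP[] := gh y I.
have gle n y : g n y <= h y.
  rewrite -(cvg_lim (@Rhausdorff R) (gcvg y)).
  apply: (@nondecreasing_cvgn_le _ (fun n => g n y)).
    by move=> a b ab; have /lefP := gnd _ _ ab; exact.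
  by apply/cvg_ex; exists (h y).
have g0 n y : 0 <= g n y by [].
have Zg0 n : (\int[mu]_t (Z t * g n (Y t))%:E = 0)%E.
  have i0 (y : R) : mu.-integrable setT
      (fun t => (Z t * \1_(g n @^-1` [set y]) (Y t))%:E).
    apply: (@integrable_mul_bounded _ _ 1) => // [|t].
      by apply: measurableT_comp => //; exact: measurable_indic.
    exact: abs_indic_le1.
  have iS (y : R) : mu.-integrable setT
      (fun t => (y * (Z t * \1_(g n @^-1` [set y]) (Y t)))%:E) by
    exact: (@integrableZ_EFin _ _ _ mu y (fun t => Z t * \1_(g n @^-1` [set y]) (Y t)) (i0 y)).
  under eq_integral => t _.
    rewrite fimfunE fsbig_finite//= mulr_sumr -sumEFin.
    under eq_bigr do rewrite mulrCA.
    over.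
  rewrite (integral_sum measurableT iS).
  apply: big1 => y _.
  under eq_integral do rewrite EFinM.
  by rewrite integralZl// Z0 ?mule0.
have [] := @dominated_convergence _ _ _ mu setT measurableT
  (fun n t => (Z t * g n (Y t))%:E) (fun t => (Z t * h (Y t))%:E)
  (fun t => `|(Z t * h (Y t))|%:E) => //.
- by move=> n; apply/measurable_EFinP; apply: measurable_funM => //; exact: measurableT_comp.
- by apply/measurable_EFinP; apply: measurable_funM => //; exact: measurableT_comp.
- apply/aeW => t _; apply: cvg_EFin; first by near=> n.
  by apply: cvgM; [exact: cvg_cst|exact: gcvg].
- exact: integrable_norm.
- by apply/aeW => t n _ /=; rewrite lee_fin !normrM ler_wpM2l// !ger0_norm.
move=> _ _; under eq_fun do rewrite Zg0.
by move=> /(cvg_unique (@ereal_hausdorff R) (cvg_cst 0%E)) <-.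
Unshelve. all: by end_near. Qed.

(** The hypothesis says that the conditional expectation of Z given Y vanishes;
    hence Z is orthogonal to every function of Y, by approximation of this
    function by simple functions. *)
Lemma integral_mul_comp0 (Z Y : T -> R) (h : R -> R) :
  measurable_fun setT Y -> measurable_fun setT h ->
  mu.-integrable setT (EFin \o Z) ->
  (forall B, measurable B -> (\int[mu]_t (Z t * \1_B (Y t))%:E = 0)%E) ->
  mu.-integrable setT (EFin \o (fun t => Z t * h (Y t))) ->
  (\int[mu]_t (Z t * h (Y t))%:E = 0)%E.
Proof.
move=> mY mh Zi Z0 Zhi.
have mZ : measurable_fun setT Z by exact/measurable_EFinP/(measurable_int _ Zi).
pose hp y := (`|h y| + h y) / 2; pose hn y := (`|h y| - h y) / 2.
have mhp : measurable_fun setT hp.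
  by apply: measurable_funM => //; apply: measurable_funD => //; exact: measurableT_comp.
have mhn : measurable_fun setT hn.
  by apply: measurable_funM => //; apply: measurable_funB => //; exact: measurableT_comp.
have hp0 y : 0 <= hp y by rewrite divr_ge0// -lerBlDr sub0r ler_normr lexx orbT.
have hn0 y : 0 <= hn y by rewrite divr_ge0// subr_ge0 ler_norm.
have hple y : `|hp y| <= `|h y|.
  by rewrite ger0_norm// /hp; have := ler_norm (h y); lra.
have hnle y : `|hn y| <= `|h y|.
  by rewrite ger0_norm// /hn; have := ler_norm (- h y); rewrite normrN; lra.
have hpi : mu.-integrable setT (EFin \o (fun t => Z t * hp (Y t))).
  apply: (le_integrable_EFin _ _ (integrable_norm Zhi)) => [|t].
    by apply: measurable_funM => //; exact: measurableT_comp.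
  by rewrite [leRHS]/= [leLHS]normrM [leRHS]normrM ler_wpM2l.
have hni : mu.-integrable setT (EFin \o (fun t => Z t * hn (Y t))).
  apply: (le_integrable_EFin _ _ (integrable_norm Zhi)) => [|t].
    by apply: measurable_funM => //; exact: measurableT_comp.
  by rewrite [leRHS]/= [leLHS]normrM [leRHS]normrM ler_wpM2l.
transitivity (\int[mu]_t ((Z t * hp (Y t))%:E - (Z t * hn (Y t))%:E))%E.
  by apply: eq_integral => t _; rewrite -EFinB; congr EFin; rewrite /hp /hn; field.
by rewrite integralB_EFin// !ge0_case// sube0.
Qed.

End zero_weight.

Section independent_marks.
Context {R : realType} (d : measure_display) (T : measurableType d).
Variable P : probability T R.

(** 1_E - P(E) is orthogonal to the indicators of events depending on X, hence
    to h(X). *)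
Lemma integral_indep_event (X : T -> R) (h : R -> R) (E : set T) :
  measurable_fun setT X -> measurable_fun setT h -> measurable E ->
  (forall B, measurable B -> P (X @^-1` B `&` E) = (P (X @^-1` B) * P E)%E) ->
  P.-integrable setT (EFin \o (fun t => h (X t))) ->
  (\int[P]_t (h (X t) * \1_E t)%:E = (\int[P]_t (h (X t))%:E) * P E)%E.
Proof.
move=> mX mh mE indep hi; set p := fine (P E).
have PE : P E = p%:E by rewrite fineK// fin_num_measure.
have m1 : measurable_fun setT (\1_E : T -> R) by exact: measurable_indic.
have b1 t : `|\1_E t - p| <= 1 + `|p|.
  apply: le_trans (ler_normB _ _) _; by rewrite lerD2r abs_indic_le1.
have mb : measurable_fun setT (fun t => \1_E t - p) by exact: measurable_funB.
have Zhi : P.-integrable setT (EFin \o (fun t => (\1_E t - p) * h (X t))).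
  have := integrable_mul_bounded mb b1 hi.
  by congr (_.-integrable _ (_ \o _)); apply/funext => t; rewrite mulrC.
have mXB B : measurable B -> measurable (X @^-1` B).
  by move=> mB; rewrite -[X in measurable X]setTI; exact: mX.
have Z1 B : measurable B -> (\int[P]_t ((\1_E t - p) * \1_B (X t))%:E = 0)%E.
  move=> mB.
  transitivity (\int[P]_t ((\1_(X @^-1` B `&` E) t)%:E - (p * \1_(X @^-1` B) t)%:E))%E.
    by apply: eq_integral => t _; rewrite -EFinB indicI mulrBl mulrC.
  have iB : P.-integrable setT (EFin \o (\1_(X @^-1` B) : T -> R)).
    by apply: integrable_indic_prob; exact: mXB.
  rewrite integralB_EFin//; last exact: integrableZ_EFin.
    under [X in (_ - X)%E]eq_integral do rewrite EFinM.
    rewrite integralZl// !integral_indic ?setIT//;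
      [|exact: mXB|by apply: measurableI => //; exact: mXB].
    by rewrite [X in (X - _)%E]indep// PE muleC subee// fin_numM// fin_num_measure//; exact: mXB.
  by apply: integrable_indic_prob; apply: measurableI => //; exact: mXB.
have Zi : P.-integrable setT (EFin \o (fun t => \1_E t - p)).
  exact: (integrableB measurableT (integrable_indic_prob P mE) (integrable_cst_prob P p)).
have := integral_mul_comp0 mX mh Zi Z1 Zhi.
have hEi : P.-integrable setT (EFin \o (fun t => h (X t) * \1_E t)).
  apply: (@integrable_mul_bounded _ _ _ _ _ _ 1) => // t.
  exact: abs_indic_le1.
rewrite (_ : (\int[P]_t ((\1_E t - p) * h (X t))%:E =
    \int[P]_t ((h (X t) * \1_E t)%:E - (p * h (X t))%:E))%E); last first.
  by apply: eq_integral => t _; rewrite -EFinB mulrBl mulrC.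
rewrite integralB_EFin//; last exact: integrableZ_EFin.
under [X in (_ - X)%E]eq_integral do rewrite EFinM.
rewrite integralZl// => /eqP; rewrite sube_eq ?add0e; last 2 first.
- exact: integrable_fin_num.
- exact: fin_num_adde_defr.
by move=> /eqP ->; rewrite PE muleC.
Qed.

Variables A tau : int -> {RV P >-> R}.
Hypothesis Aindep : independent_family P (fun k => A k : T -> R).
Hypothesis Atau : independent_families P (fun k => A k : T -> R) (fun k => tau k : T -> R).
Variables (v : R) (g : R -> R) (M : R).
Hypothesis A1 : forall k, (\int[P]_t (A k t)%:E = 0)%E.
Hypothesis A2 : forall k, (\int[P]_t (A k t ^+ 2)%:E = v%:E)%E.
Hypothesis mg : measurable_fun setT g.
Hypothesis gM : forall x, `|g x| <= M.

Let mA k : measurable_fun setT (A k). Proof. by []. Qed.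
Let mtau k : measurable_fun setT (tau k). Proof. by []. Qed.

Let measurable_pre (X : T -> R) B : measurable_fun setT X -> measurable B ->
  measurable (X @^-1` B).
Proof. by move=> mX mB; rewrite -[X in measurable X]setTI; exact: mX. Qed.

Let mgtau k : measurable_fun setT (fun t => g (tau k t)).
Proof. exact: measurableT_comp. Qed.

Let iA2 k : P.-integrable setT (EFin \o (fun t => A k t ^+ 2)).
Proof.
apply/integrableP; split.
  by apply/measurable_EFinP; exact: measurable_funX.
by under eq_integral do rewrite /= ger0_norm ?sqr_ge0//; rewrite A2 ltry.
Qed.

Let iA k : P.-integrable setT (EFin \o A k).
Proof. exact: integrable_of_sqr. Qed.

Let iAA i j : P.-integrable setT (EFin \o (fun t => A i t * A j t)).
Proof.
apply: (le_integrable_EFin _ _ (integrableD measurableT (iA2 i) (iA2 j))) => [|t].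
  exact: measurable_funM.
rewrite normrM -(real_normK (num_real (A i t))) -(real_normK (num_real (A j t))).
have := normr_ge0 (A i t); have := normr_ge0 (A j t); nra.
Qed.

Let indic_le1 (B : set R) (X : T -> R) t : `|\1_B (X t)| <= 1 :> R.
Proof. exact: abs_indic_le1. Qed.

Let mindic (B : set R) (X : T -> R) : measurable B -> measurable_fun setT X ->
  measurable_fun setT (fun t => \1_B (X t) : R).
Proof. by move=> mB mX; apply: measurableT_comp => //; exact: measurable_indic. Qed.

Let indic_pre (B : set R) (X : T -> R) t : \1_(X @^-1` B) t = \1_B (X t) :> R.
Proof. by []. Qed.

Lemma indep_marks2 i j B1 B2 C1 C2 : i != j ->
  measurable B1 -> measurable B2 -> measurable C1 -> measurable C2 ->
  P (A i @^-1` B1 `&` (A j @^-1` B2 `&` (tau i @^-1` C1 `&` tau j @^-1` C2))) =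
  (P (A i @^-1` B1) * P (A j @^-1` B2 `&` (tau i @^-1` C1 `&` tau j @^-1` C2)))%E.
Proof.
move=> ij mB1 mB2 mC1 mC2.
have ji : (j == i) = false by rewrite eq_sym; exact/negbTE.
have key D1 : measurable D1 ->
    P (A i @^-1` D1 `&` (A j @^-1` B2 `&` (tau i @^-1` C1 `&` tau j @^-1` C2))) =
    (P (A i @^-1` D1) * P (A j @^-1` B2) * P (tau i @^-1` C1 `&` tau j @^-1` C2))%E.
  move=> mD1.
  pose B k := if k == i then D1 else B2; pose C k := if k == i then C1 else C2.
  have mB k : measurable (B k) by rewrite /B; case: ifP.
  have mC k : measurable (C k) by rewrite /C; case: ifP.
  have := Atau [:: i; j] [:: i; j] mB mC.
  rewrite Aindep//; last by rewrite /= inE ij.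
  rewrite /joint_event !big_cons !big_nil /B /C !eqxx ji/= !setIT mule1 => <-.
  by rewrite setIA.
rewrite key//; have := key _ measurableT; rewrite preimage_setT setTI => ->.
by rewrite probability_setT mul1e muleA.
Qed.

(** The amplitudes are the marks of the points tau_k. Conditionally on the
    locations and on the second mark, the first mark has mean zero. Starting from
    indicators of A_j, tau_i and tau_j, the proof replaces one indicator after
    the other by the function that occurs in the statement. *)
Lemma marks_orthogonal i j : i != j ->
  (\int[P]_t ((A i t * g (tau i t)) * (A j t * g (tau j t)))%:E = 0)%E.
Proof.
move=> ij.
have s1 B2 C1 C2 : measurable B2 -> measurable C1 -> measurable C2 ->
    (\int[P]_t (A i t * \1_C1 (tau i t) * \1_C2 (tau j t) * \1_B2 (A j t))%:E = 0)%E.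
  move=> mB2 mC1 mC2.
  pose E := A j @^-1` B2 `&` (tau i @^-1` C1 `&` tau j @^-1` C2).
  have mE : measurable E by do !apply: measurableI; exact: measurable_pre.
  have := @integral_indep_event (A i) id E (mA i) (@measurable_id _ _ _) mE.
  move=> /(_ (fun B mB => indep_marks2 ij mB mB2 mC1 mC2) (iA i)).
  rewrite /= A1 mul0e => <-; apply: eq_integral => t _.
  by rewrite /E !indicI /= !indic_pre; congr EFin; ring.
have s2 C1 C2 : measurable C1 -> measurable C2 ->
    (\int[P]_t (A i t * \1_C1 (tau i t) * \1_C2 (tau j t) * A j t)%:E = 0)%E.
  move=> mC1 mC2; apply: (@integral_mul_comp0 _ _ _ P _ (A j) id) => //.
  - apply: (@integrable_mul_bounded _ _ _ _ _ _ 1) => //; first exact: mindic.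
    by apply: (@integrable_mul_bounded _ _ _ _ _ _ 1) => //; exact: mindic.
  - by move=> B mB; exact: s1.
  - have -> : (fun t => A i t * \1_C1 (tau i t) * \1_C2 (tau j t) * id (A j t)) =
      (fun t => A i t * A j t * \1_C1 (tau i t) * \1_C2 (tau j t)).
      by apply/funext => t /=; ring.
    apply: (@integrable_mul_bounded _ _ _ _ _ _ 1) => //; first exact: mindic.
    by apply: (@integrable_mul_bounded _ _ _ _ _ _ 1) => //; exact: mindic.
have s3 C2 : measurable C2 ->
    (\int[P]_t (A i t * A j t * \1_C2 (tau j t) * g (tau i t))%:E = 0)%E.
  move=> mC2; apply: (@integral_mul_comp0 _ _ _ P _ (tau i) g) => //.
  - by apply: (@integrable_mul_bounded _ _ _ _ _ _ 1) => //; exact: mindic.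
  - move=> C1 mC1; rewrite -(s2 C1 C2)//; apply: eq_integral => t _.
    by congr EFin; ring.
  - apply: (@integrable_mul_bounded _ _ _ _ _ _ M) => //.
    by apply: (@integrable_mul_bounded _ _ _ _ _ _ 1) => //; exact: mindic.
transitivity (\int[P]_t (A i t * A j t * g (tau i t) * g (tau j t))%:E)%E.
  by apply: eq_integral => t _; congr EFin; ring.
apply: (@integral_mul_comp0 _ _ _ P _ (tau j) g) => //.
- exact: (@integrable_mul_bounded _ _ _ _ _ _ M).
- move=> C2 mC2; rewrite -(s3 C2)//; apply: eq_integral => t _.
  by congr EFin; ring.
- by do 2!apply: (@integrable_mul_bounded _ _ _ _ _ _ M) => //.
Qed.

(** A_i^2 - v is orthogonal to every function of tau_i, by independence. *)
Lemma mark_second_moment i :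
  (\int[P]_t ((A i t * g (tau i t)) ^+ 2)%:E = v%:E * \int[P]_t (g (tau i t) ^+ 2)%:E)%E.
Proof.
have mg2 : measurable_fun setT (fun x => g x ^+ 2) by exact: measurable_funX.
have g2M x : `|g x ^+ 2| <= M ^+ 2.
  by rewrite normrX lerXn2r ?nnegrE// (le_trans _ (gM x)).
have s1 C : measurable C ->
    (\int[P]_t ((A i t ^+ 2 - v) * \1_C (tau i t))%:E = 0)%E.
  move=> mC; pose E := tau i @^-1` C.
  have mE : measurable E by exact: measurable_pre.
  have indepE B : measurable B -> P (A i @^-1` B `&` E) = (P (A i @^-1` B) * P E)%E.
    move=> mB; have := Atau [:: i] [:: i] (fun _ => mB) (fun _ => mC).
    by rewrite /joint_event !big_cons !big_nil !setIT.
  have := @integral_indep_event (A i) (fun x => x ^+ 2) E (mA i) _ mE indepE (iA2 i).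
  move=> /(_ (measurable_funX _ (@measurable_id _ _ _))).
  rewrite A2 => h.
  transitivity (\int[P]_t ((A i t ^+ 2 * \1_E t)%:E - (v * \1_E t)%:E))%E.
    by apply: eq_integral => t _; rewrite -EFinB -mulrBl.
  rewrite integralB_EFin//.
  - rewrite h; under eq_integral do rewrite EFinM.
    rewrite integralZl//; last exact: integrable_indic_prob.
    by rewrite integral_indic// setIT subee// fin_numM// fin_num_measure.
  - apply: (integrable_mul_bounded (M := 1)) (iA2 i); first exact: measurable_indic.
    exact: (indic_le1 C (tau i)).
  - by apply: integrableZ_EFin; exact: integrable_indic_prob.
have iA2v : P.-integrable setT (EFin \o (fun t => A i t ^+ 2 - v)).
  exact: (integrableB measurableT (iA2 i) (integrable_cst_prob P v)).
have mg2tau : measurable_fun setT (fun t => g (tau i t) ^+ 2) by exact: measurable_funX.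
have ig2 : P.-integrable setT (EFin \o (fun t => g (tau i t) ^+ 2)).
  by apply: (le_integrable_EFin _ _ (integrable_cst_prob P (M ^+ 2))) => // t; exact: g2M.
have iAg : P.-integrable setT (EFin \o (fun t => A i t ^+ 2 * g (tau i t) ^+ 2)).
  by apply: (@integrable_mul_bounded _ _ _ _ _ _ (M ^+ 2)) => // t; exact: g2M.
have := @integral_mul_comp0 _ _ _ P (fun t => A i t ^+ 2 - v) (tau i)
  (fun x => g x ^+ 2) (mtau i) mg2 iA2v s1.
move=> /(_ (integrable_mul_bounded mg2tau (fun t => g2M _) iA2v)).
rewrite (_ : (\int[P]_t ((A i t ^+ 2 - v) * g (tau i t) ^+ 2)%:E =
    \int[P]_t ((A i t ^+ 2 * g (tau i t) ^+ 2)%:E - (v * g (tau i t) ^+ 2)%:E))%E); last first.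
  by apply: eq_integral => t _; rewrite -EFinB -mulrBl.
rewrite integralB_EFin//; last exact: integrableZ_EFin.
under [X in (_ - X)%E]eq_integral do rewrite EFinM.
rewrite integralZl// => /eqP; rewrite sube_eq ?add0e; last 2 first.
- exact: integrable_fin_num.
- exact: fin_num_adde_defr.
by move=> /eqP <-; apply: eq_integral => t _; rewrite exprMn.
Qed.

Lemma mark_sqr_integrable i :
  P.-integrable setT (EFin \o (fun t => (A i t * g (tau i t)) ^+ 2)).
Proof.
have := @integrable_mul_bounded _ _ _ P (fun t => A i t ^+ 2) (fun t => g (tau i t) ^+ 2)
  (M ^+ 2) (measurable_funX _ (mgtau i)) _ (iA2 i).
rewrite (_ : (fun t => A i t ^+ 2 * g (tau i t) ^+ 2) =
    (fun t => (A i t * g (tau i t)) ^+ 2)); last first.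
  by apply/funext => t; rewrite exprMn.
by apply => t; rewrite normrX lerXn2r ?nnegrE// (le_trans _ (gM (tau i t))).
Qed.

End independent_marks.

(** * Orthogonal series *)

Section orthogonal_series.
Context {R : realType} (d : measure_display) (T : measurableType d).
Variable mu : {measure set T -> \bar R}.
Variables (y : nat -> T -> R) (c : nat -> R).
Hypothesis my : forall i, measurable_fun setT (y i).
Hypothesis iy : forall i, mu.-integrable setT (EFin \o (fun t => y i t ^+ 2)).
Hypothesis yy0 : forall i j, i != j -> (\int[mu]_t (y i t * y j t)%:E = 0)%E.
Hypothesis y2 : forall i, (\int[mu]_t (y i t ^+ 2)%:E = (c i)%:E)%E.

Let iyy i j : mu.-integrable setT (fun t => (y i t * y j t)%:E).
Proof.
apply: (@le_integrable_EFin _ _ _ mu (fun t => y i t * y j t) _ _ _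
  (integrableD measurableT (iy i) (iy j))) => [|t]; first exact: measurable_funM.
rewrite normrM -(real_normK (num_real (y i t))) -(real_normK (num_real (y j t))).
have := normr_ge0 (y i t); have := normr_ge0 (y j t); nra.
Qed.

Let msum s : measurable_fun setT (fun t => \sum_(i <- s) y i t).
Proof. by apply: measurable_sum => i; exact: my. Qed.

Lemma integral_sqr_orthogonal s : uniq s ->
  (\int[mu]_t ((\sum_(i <- s) y i t) ^+ 2)%:E = (\sum_(i <- s) c i)%:E)%E.
Proof.
move=> us.
have i1 i : mu.-integrable setT (fun t => \sum_(j <- s) (y i t * y j t)%:E)%E.
  exact: integrable_sum.
under eq_integral => t _.
  rewrite expr2 big_distrlr/= -sumEFin.
  under eq_bigr do rewrite -sumEFin.
  over.
rewrite (integral_sum measurableT i1) -sumEFin big_seq [RHS]big_seq.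
apply: eq_bigr => i is_; rewrite (integral_sum measurableT (iyy i)).
rewrite (bigD1_seq i)//= -y2 big1 ?adde0// => j ji.
by apply: yy0; rewrite eq_sym.
Qed.

Variables (X : T -> R) (S : R).
Hypothesis mX : measurable_fun setT X.
Hypothesis cS : series c @ \oo --> S.
Hypothesis yX : {ae mu, forall t, \sum_(i < K.*2.+1) y i t @[K --> \oo] --> X t}.

(* Fatou's lemma for the partial sums of odd length (M + N).*2.+1 >= N, along
   which the series converges to X. *)
Let remainder_le N :
  (\int[mu]_t ((X t - \sum_(0 <= i < N) y i t) ^+ 2)%:E <= (S - series c N)%:E)%E.
Proof.
pose b M := (M + N).*2.+1.
have MNb M : (M + N <= b M)%N by rewrite /b -addnn leqW// leq_addr.
have Nb M : (N <= b M)%N := leq_trans (leq_addl M N) (MNb M).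
pose f M t := (\sum_(N <= i < b M) y i t) ^+ 2.
have mf M : measurable_fun setT (fun t => (f M t)%:E).
  by apply/measurable_EFinP; apply: measurable_funX; exact: msum.
have f0 M t : (0 <= (f M t)%:E)%E by rewrite lee_fin sqr_ge0.
have bcvg : b @ \oo --> \oo.
  apply/cvgnyPge => K; near=> M; apply: leq_trans (MNb M); apply: leq_trans (leq_addr N M).
  by near: M; exact: nbhs_infty_ge.
have intf M : (\int[mu]_t (f M t)%:E = (series c (b M) - series c N)%:E)%E.
  rewrite integral_sqr_orthogonal ?iota_uniq//; congr EFin.
  by rewrite /series/= [in RHS](@big_cat_nat _ _ _ N)//= addrAC subrr add0r.
have lim1 : (\int[mu]_t (f M t)%:E)%E @[M --> \oo] --> (S - series c N)%:E.
  under eq_fun do rewrite intf.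
  apply: cvg_EFin; first by near=> M.
  by apply: cvgB; [exact: (cvg_comp _ _ bcvg cS)|exact: cvg_cst].
have := @fatou _ _ _ mu setT measurableT (fun M t => (f M t)%:E) mf (fun M t _ => f0 M t).
rewrite (cvg_limn_einf_sup lim1).1; apply: le_trans.
rewrite le_eqVlt; apply/orP; left; apply/eqP.
apply: ae_eq_integral => //.
- apply/measurable_EFinP; apply: measurable_funX; apply: measurable_funB => //; exact: msum.
- apply: (measurableT_comp (@oppe_measurable R setT)).
  by apply: measurable_fun_limn_esup => M; exact: measurableT_comp.
have [Z [mZ Z0 ZX]] := yX; exists Z; split=> // t nt; apply: ZX => ht; apply: nt => _.
have sN : \sum_(N <= i < b M) y i t @[M --> \oo] --> X t - \sum_(0 <= i < N) y i t.
  have hb : \sum_(0 <= i < b M) y i t @[M --> \oo] --> X t.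
    have := cvg_comp _ _ (cvg_addnr N) ht; apply: cvg_trans; apply: near_eq_cvg.
    by near=> M; rewrite /= big_mkord.
  have yN M : \sum_(N <= i < b M) y i t = \sum_(0 <= i < b M) y i t - \sum_(0 <= i < N) y i t.
    by rewrite [in RHS](@big_cat_nat _ _ _ N)//= addrAC subrr add0r.
  under eq_fun do rewrite yN.
  by apply: cvgB hb _; exact: cvg_cst.
have : (f M t)%:E @[M --> \oo] --> ((X t - \sum_(0 <= i < N) y i t) ^+ 2)%:E.
  apply: cvg_EFin; first by near=> M.
  by rewrite expr2; under eq_fun do rewrite /f expr2; exact: cvgM.
by move=> /cvg_limn_einf_sup[->].
Unshelve. all: by end_near. Qed.

(** Orthogonality makes the squared L2 distance between two partial sums a block
    of the convergent series of c, and Fatou's lemma lets one of them tend to X: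
    the remainders of [c] bound the distance from X to the partial sums. The
    almost sure convergence of the symmetric partial sums is thus also an L2
    convergence, and the second moments pass to the limit. *)
Lemma integral_sqr_orthogonal_series : (\int[mu]_t (X t ^+ 2)%:E = S%:E)%E.
Proof.
have X20 : (0 <= \int[mu]_t (X t ^+ 2)%:E)%E.
  by apply: integral_ge0 => t _; rewrite lee_fin sqr_ge0.
have leS : (\int[mu]_t (X t ^+ 2)%:E <= S%:E)%E.
  have := remainder_le 0; rewrite /series/= big_geq// subr0; apply: le_trans.
  rewrite le_eqVlt; apply/orP; left; apply/eqP; apply: eq_integral => t _.
  by rewrite big_geq// subr0.
have Xfin : (\int[mu]_t (X t ^+ 2)%:E)%E \is a fin_num.
  by rewrite ge0_fin_numE// (le_lt_trans leS)// ltry.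
set m := fine (\int[mu]_t (X t ^+ 2)%:E)%E.
have X2m : (\int[mu]_t (X t ^+ 2)%:E)%E = m%:E by rewrite fineK.
move: X20 leS; rewrite X2m !lee_fin => m0 mS; congr EFin.
apply/eqP; rewrite eq_le mS/=.
(* With S_N the partial sum, S_N^2 <= (1 + e) X^2 + (1 + 1/e) (X - S_N)^2; the
   last term tends to 0 in mean as N grows, and then e tends to 0. *)
have key e : 0 < e -> S <= (1 + e) * m.
  move=> e0; have e1 : 0 < e^-1 by rewrite invr_gt0.
  have le1 N : series c N <= (1 + e) * m + (1 + e^-1) * (S - series c N).
    rewrite -lee_fin -[series c N]/(\sum_(i <- index_iota 0 N) c i).
    rewrite -integral_sqr_orthogonal ?iota_uniq//.
    have mXN : measurable_fun setT (fun t => (X t - \sum_(0 <= i < N) y i t) ^+ 2).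
      apply: measurable_funX; apply: measurable_funB => //; exact: msum.
    have mX2 : measurable_fun setT (fun t => X t ^+ 2) by exact: measurable_funX.
    apply: (@le_trans _ _ (\int[mu]_t ((1 + e)%:E * (X t ^+ 2)%:E +
        (1 + e^-1)%:E * ((X t - \sum_(0 <= i < N) y i t) ^+ 2)%:E))%E).
      apply: ge0_le_integral => //.
      - by move=> t _; rewrite lee_fin sqr_ge0.
      - by apply/measurable_EFinP; apply: measurable_funX; exact: msum.
      - apply: emeasurable_funD; apply/measurable_EFinP; exact: measurable_funM.
      - move=> t _; rewrite -!EFinM -EFinD lee_fin.
        set x := X t; set z := \sum_(i <- _) y i t.
        rewrite -subr_ge0.
        have -> : (1 + e) * x ^+ 2 + (1 + e^-1) * (x - z) ^+ 2 - z ^+ 2 =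
            e^-1 * ((1 + e) * x - z) ^+ 2 by field; rewrite gt_eqF.
        by rewrite mulr_ge0 ?sqr_ge0// ltW.
    rewrite ge0_integralD//; last 4 first.
    - by move=> t _; rewrite -EFinM lee_fin mulr_ge0 ?sqr_ge0// addr_ge0// ltW.
    - by apply/measurable_EFinP; exact: measurable_funM.
    - by move=> t _; rewrite -EFinM lee_fin mulr_ge0 ?sqr_ge0// addr_ge0// ltW.
    - by apply/measurable_EFinP; exact: measurable_funM.
    rewrite !ge0_integralZl//; last 6 first.
    - exact/measurable_EFinP.
    - by move=> t _; rewrite lee_fin sqr_ge0.
    - by rewrite lee_fin addr_ge0// ltW.
    - exact/measurable_EFinP.
    - by move=> t _; rewrite lee_fin sqr_ge0.
    - by rewrite lee_fin addr_ge0// ltW.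
    rewrite X2m [leRHS]EFinD [X in (_ <= X + _)%E]EFinM leeD2l//.
    by rewrite [leRHS]EFinM lee_wpmul2l ?lee_fin ?addr_ge0 ?(ltW e1)//.
  have : (1 + e) * m + (1 + e^-1) * (S - series c N) @[N --> \oo] -->
      (1 + e) * m + (1 + e^-1) * (S - S).
    apply: cvgD; first exact: cvg_cst.
    by apply: cvgM; [exact: cvg_cst|apply: cvgB => //; exact: cvg_cst].
  rewrite subrr mulr0 addr0 => lim2.
  by apply: (ler_cvg_to cS lim2); near=> N; exact: le1.
rewrite leNgt; apply/negP => ltmS.
have m1 : 0 < 2 * (m + 1) by rewrite mulr_gt0// ltr_wpDl.
have := key ((S - m) / (2 * (m + 1))); rewrite divr_gt0// ?subr_gt0// => /(_ isT).
have : (S - m) / (2 * (m + 1)) * m <= (S - m) / 2.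
  rewrite mulrAC -mulrA ler_wpM2l ?subr_ge0// ler_pdivrMr//; lra.
lra.
Unshelve. all: by end_near. Qed.

End orthogonal_series.

(** * Enumeration of the integers *)

Section enumeration.

(** The order 0, 1, -1, 2, -2, ..., whose initial segments of odd length are
    the symmetric intervals. *)
Definition zenum (i : nat) : int := if odd i then i./2.+1%:Z else - (i./2)%:Z.

Definition zrank (k : int) : nat := if k is Posz m.+1 then m.*2.+1 else `|k|.*2.

Lemma zenumK : cancel zenum zrank.
Proof.
move=> i; rewrite /zenum; case: ifPn => oi /=.
  by rewrite -[RHS]odd_double_half oi.
by rewrite -[RHS]odd_double_half (negbTE oi) add0n; case: (i./2).
Qed.

Lemma zrankK : cancel zrank zenum.
Proof.
case=> [[|m]|m]; rewrite /zenum/=.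
- by [].
- by rewrite odd_double/= uphalf_double.
- by rewrite negbK odd_double/= doubleK NegzE.
Qed.

Lemma sum_zenum (V : nmodType) (x : int -> V) K :
  \sum_(i < K.*2.+1) x (i%:Z - K%:Z) = \sum_(i < K.*2.+1) x (zenum i).
Proof.
elim: K => [|K IH]; first by rewrite !big_ord1 subrr.
rewrite doubleS big_ord_recl big_ord_recr/= [RHS]big_ord_recr/= [in RHS]big_ord_recr/= -IH.
rewrite /zenum/= negbK !odd_double/= doubleK uphalf_double.
rewrite addrC; congr (_ + _ + _); first by apply: eq_bigr => i _; congr x; rewrite /bump; lia.
- by congr x; rewrite /bump; lia.
- by congr x; lia.
Qed.

End enumeration.

(** * Mean measure of a Poisson process *)

Section poisson_mean.
Context {R : realType}.
Implicit Type l : R.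

Lemma poisson_pmf_sum l : 0 < l -> (\sum_(0 <= m <oo) (poisson_pmf l m)%:E = 1)%E.
Proof.
move=> l0; rewrite nneseries_esumT; last by move=> m; rewrite lee_fin poisson_pmf_ge0.
transitivity (poisson_prob l 0 setT); first by rewrite /poisson_prob l0.
exact: probability_setT.
Qed.

Lemma poisson_pmf_mean l : 0 < l ->
  (\sum_(0 <= m <oo) (m%:R * poisson_pmf l m)%:E = l%:E)%E.
Proof.
move=> l0; have ge0 m : (0 <= (m%:R * poisson_pmf l m)%:E)%E.
  by rewrite lee_fin mulr_ge0// poisson_pmf_ge0.
rewrite nneseries_recl// mul0r add0e -(@nneseries_addn _ _ 1)//.
transitivity (\sum_(0 <= m <oo) (l%:E * (poisson_pmf l m)%:E))%E; last first.
  by rewrite nneseriesZl ?poisson_pmf_sum ?mule1// => m _; rewrite lee_fin poisson_pmf_ge0.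
apply: eq_eseriesr => m _; rewrite -EFinM; congr EFin.
rewrite /poisson_pmf l0 addn1 factS exprS natrM; field.
by rewrite nat1r !pnatr_eq0 -lt0n fact_gt0.
Qed.

End poisson_mean.

Section intensity.
Context {R : realType} (d : measure_display) (T : measurableType d).
Local Notation leb := (@lebesgue_measure R).

Lemma counting_zenum (D : set int) :
  counting D = counting (zenum @^-1` D) :> \bar R.
Proof.
have DE : zenum @` (zenum @^-1` D) = D.
  apply/seteqP; split=> [_ [i Di <-]//|k Dk].
  by exists (zrank k); rewrite /= zrankK.
have ED : zrank @` D = zenum @^-1` D.
  apply/seteqP; split=> [_ [k Dk <-]/=|i Di]; first by rewrite zrankK.
  by exists (zenum i) => //; rewrite zenumK.
rewrite /counting; case: (pselect (finite_set D)) => finD; last first.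
  rewrite !asboolF// => finE; apply: finD; rewrite -DE; exact: finite_image.
have finE : finite_set (zenum @^-1` D) by rewrite -ED; exact: finite_image.
rewrite !asboolT// -{1}DE fset_set_image// finmap.card_imfset//.
exact: can_inj zenumK.
Qed.

Variables (P : probability T R) (tau : int -> {RV P >-> R}).

Lemma point_count_zenum (B : set R) t :
  point_count (fun k => tau k : T -> R) B t =
  (\sum_(0 <= i <oo) (\1_B (tau (zenum i) t))%:E)%E.
Proof.
by rewrite /point_count counting_zenum counting_dirac; apply: eq_eseriesr.
Qed.

Variable lambda : R.
Hypothesis lambda0 : 0 < lambda.
Hypothesis Htau : poisson_process P lambda (fun k => tau k : T -> R).

Let measurable_pre B k : measurable B -> measurable (tau k @^-1` B).
Proof. by move=> mB; rewrite -[X in measurable X]setTI; exact: measurable_funPT. Qed.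

(* The number N of points in [a, b] is the sum over k of the indicators of
   tau_k in [a, b]; being a Poisson variable it is almost surely finite, and its
   mean is the sum of m P(N = m). *)
Let mean_count_itv (a b : R) : a < b ->
  (\sum_(0 <= i <oo) P (tau (zenum i) @^-1` `[a, b]) = (lambda * (b - a))%:E)%E.
Proof.
move=> ab; have [Hcount _] := Htau.
pose N := point_count (fun k => tau k : T -> R) `[a, b].
have l0 : 0 < lambda * (b - a) by rewrite mulr_gt0 ?subr_gt0.
have NE : N = (fun t => \sum_(0 <= i <oo) (\1_`[a, b] (tau (zenum i) t))%:E)%E.
  by apply/funext => t; exact: point_count_zenum.
have m1 i : measurable_fun setT (fun t => (\1_`[a, b] (tau (zenum i) t) : R)%:E).
  by apply/measurable_EFinP; apply: measurableT_comp => //; exact: measurable_indic.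
have mN : measurable_fun setT N.
  by rewrite NE; apply: ge0_emeasurable_sum => // i t _ _; rewrite lee_fin.
have N0 t : (0 <= N t)%E.
  by rewrite NE; apply: nneseries_ge0 => i _ _; rewrite lee_fin.
pose E m := [set t | N t = m%:R%:E].
have mE m : measurable (E m).
  have -> : E m = setT `&` N @^-1` [set m%:R%:E] by rewrite setTI.
  exact: mN.
have tE : trivIset setT E.
  apply/trivIsetP => i j _ _ ij; rewrite -subset0 => t [Ei Ej].
  by move: Ei; rewrite /E/= Ej => -[/eqP]; rewrite eqr_nat eq_sym (negbTE ij).
have PE m : P (E m) = (poisson_pmf (lambda * (b - a)) m)%:E by exact: Hcount.
pose D := \bigcup_m E m.
have mD : measurable D by exact: bigcup_measurable.
have PD : P D = 1%E.
  rewrite measure_bigcup// -(poisson_pmf_sum l0) (@eq_eseriesl _ _ xpredT); last first.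
    by move=> i; rewrite in_setT.
  by apply: eq_eseriesr => i _; exact: PE.
have intN : (\int[P]_t N t = \sum_(0 <= i <oo) P (tau (zenum i) @^-1` `[a, b]))%E.
  rewrite NE integral_nneseries//.
    apply: eq_eseriesr => i _; rewrite -[LHS]/(\int[P]_t (\1_(tau (zenum i) @^-1` `[a, b]) t)%:E)%E.
    by rewrite integral_indic ?setIT//; exact: measurable_pre.
have PDC : P (~` D) = 0%E by rewrite probability_setC// PD subee.
rewrite -intN (@ge0_negligible_integral _ _ _ P setT (~` D))//; last exact: measurableC.
rewrite setDE setCK setTI ge0_integral_bigcup//; last exact: measurable_funS mN.
rewrite -(poisson_pmf_mean l0); apply: eq_eseriesr => m _.
transitivity (\int[P]_(t in E m) (m%:R%:E : \bar R))%E.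
  by apply: eq_integral => t; rewrite inE.
by rewrite integral_cst// [X in (_ * X)%E]PE -EFinM.
Qed.

Let mtau' i : measurable_fun setT (tau i : T -> measurableTypeR R).
Proof. by move=> _ B mB; rewrite setTI; exact: measurable_pre. Qed.

Let tau' i : {mfun T >-> measurableTypeR R} := 
  @mfun_Sub _ _ T (measurableTypeR R) (tau (zenum i)) (mem_set (mtau' (zenum i))).

Let nu : {measure set (measurableTypeR R) -> \bar R} :=
  mseries (fun i => distribution P (tau' i) : {measure set (measurableTypeR R) -> \bar R}) 0.

Let nu_itv (a b : R) : a < b -> nu `[a, b]%classic = (lambda * (b - a))%:E.
Proof. exact: mean_count_itv. Qed.

Let nu1 (a : R) : nu [set a] = 0%E.
Proof.
apply/eqP; rewrite eq_le measure_ge0 andbT; apply/lee_addgt0Pr => e e0.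
rewrite add0e; have ae : a < a + e / lambda by rewrite ltrDl divr_gt0.
have := nu_itv ae; rewrite (_ : lambda * _ = e); last by field; rewrite gt_eqF.
move=> <-.
apply: le_measure; rewrite ?inE//.
by move=> x ->; rewrite /= in_itv/= lexx ltW.
Qed.

Let nu_ocitv (a b : R) : a < b -> nu `]a, b]%classic = (lambda * (b - a))%:E.
Proof.
move=> ab; rewrite -nu_itv// -(@setU1itv _ _ (BRight b) a false) ?bnd_simp ?ltW//.
rewrite measureU//; first by rewrite -[LHS]add0e; congr (_ + _)%E; exact/esym/nu1.
by rewrite -subset0 => x [/= ->]; rewrite in_itv/= ltxx.
Qed.

(** The sum over k of the laws of tau_k is lambda times the Lebesgue measure,
    because the two measures agree on intervals, where the former is the mean
    number of points. *)
Lemma campbell (g : R -> R) : measurable_fun setT g -> (forall x, 0 <= g x) ->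
  (\sum_(0 <= i <oo) \int[P]_t (g (tau (zenum i) t))%:E =
   lambda%:E * \int[leb]_x (g x)%:E)%E.
Proof.
move=> mg g0.
have mgE : measurable_fun setT (fun x : measurableTypeR R => (g x)%:E).
  exact/measurable_EFinP.
have linv0 : 0 <= lambda^-1 by rewrite invr_ge0 ltW.
pose m := mscale (NngNum linv0) nu.
have legm (A : set (measurableTypeR R)) : measurable A -> leb A = m A.
  move=> mA; apply: (@lebesgue_measure_unique R m) => // X /ocitvP[->|[[a b]/= ab ->]].
    by rewrite !measure0.
  rewrite /m /mscale/= nu_ocitv// lebesgue_measure_itv/= lte_fin ab -EFinM mulKf ?gt_eqF//.
rewrite (eq_measure_integral m); last by move=> A mA _; exact: legm.
rewrite ge0_integral_mscale//; last by move=> x _; rewrite lee_fin.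
rewrite muleA -EFinM/= divff ?gt_eqF// mul1e.
rewrite ge0_integral_measure_series//; last by move=> x _; rewrite lee_fin.
apply: eq_eseriesr => i _.
by rewrite ge0_integral_distribution.
Qed.

End intensity.

(** * Second moment of a compound-Poisson innovation *)

Section compound_poisson.
Context {R : realType} (d : measure_display) (T : measurableType d).
Local Notation leb := (@lebesgue_measure R).

Lemma tempered_eval_cvg (psi : schwartz R) (F : nat -> tempered R) (u : tempered R) :
  F @ \oo --> u -> F K psi @[K --> \oo] --> u psi.
Proof.
move=> Fu.
have evc : continuous (fun v : tempered R => v psi).
  move=> v.
  apply: (@continuous_comp _ _ _ (@tempered_eval R)
    (@proj _ (fun _ : schwartz R => R) psi)).
    exact: initial_continuous.
  exact: proj_continuous.
exact: (cvg_comp _ _ Fu (evc u)).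
Qed.

Lemma tempered_sumE (psi : schwartz R) n (a x : nat -> R) :
  (\sum_(i < n) a i *: delta (x i) : tempered R) psi = \sum_(i < n) a i * psi (x i).
Proof. by elim/big_ind2: _ => // u1 r1 u2 r2 <- <-. Qed.

Variables (P : probability T R) (tau A : int -> {RV P >-> R}).
Variables (lambda v : R) (w : generalized_process T R).
Hypothesis lambda0 : 0 < lambda.
Hypothesis Hw : compound_poisson_innovation lambda tau A w.
Hypothesis A1 : forall k, (\int[P]_t (A k t)%:E = 0)%E.
Hypothesis A2 : forall k, (\int[P]_t (A k t ^+ 2)%:E = v%:E)%E.

(** <psi, w> is the almost sure sum of the orthogonal variables A_k psi(tau_k),
    of second moment v E[psi(tau_k)^2], and the sum of E[psi(tau_k)^2] over k is
    lambda times the integral of psi^2. *)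
Lemma compound_poisson_second_moment (psi : schwartz R) :
  (\int[P]_t (w t psi ^+ 2)%:E = (lambda * v * \int[leb]_x (psi x ^+ 2))%:E)%E.
Proof.
have [Htau [Aindep _] Atau wE] := Hw.
have [M psiM] := schwartz_bounded psi.
have mpsi := schwartz_measurable psi.
pose y i t := A (zenum i) t * psi (tau (zenum i) t).
have my i : measurable_fun setT (y i).
  by apply: measurable_funM => //; exact: measurableT_comp.
have mpsi2 : measurable_fun setT (fun x => psi x ^+ 2) by exact: measurable_funX.
have camp := campbell lambda0 Htau mpsi2 (fun x => sqr_ge0 (psi x)).
have psi2E : (\int[leb]_x (psi x ^+ 2)%:E)%E = (\int[leb]_x (psi x ^+ 2))%:E.
  by rewrite /Rintegral fineK//; apply: integrable_fin_num => //; exact: schwartz_sqr_integrable.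
pose b i := \int[P]_t (psi (tau (zenum i) t) ^+ 2).
have bE i : (\int[P]_t (psi (tau (zenum i) t) ^+ 2)%:E)%E = (b i)%:E.
  rewrite /b /Rintegral fineK//; apply: integrable_fin_num => //.
  apply: (le_integrable_EFin _ _ (integrable_cst_prob P (M ^+ 2))) => [|t].
    by apply: measurable_funX; exact: measurableT_comp.
  by rewrite normrX lerXn2r ?nnegrE// (le_trans _ (psiM 0)).
rewrite psi2E -EFinM in camp.
have b0 i : (0 <= (b i)%:E)%E by rewrite lee_fin Rintegral_ge0// => t _; exact: sqr_ge0.
have bcvg : series b @ \oo --> lambda * \int[leb]_x (psi x ^+ 2).
  have : (\sum_(0 <= i < N) (b i)%:E)%E @[N --> \oo] --> (lambda * \int[leb]_x (psi x ^+ 2))%:E.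
    rewrite -camp (eq_eseriesr (fun i _ => bE i)).
    exact: (@is_cvg_nneseries R (fun i => (b i)%:E) xpredT 0 (fun i _ _ => b0 i)).
  by under eq_fun do rewrite sumEFin; move=> /fine_cvgP[].
apply: (@integral_sqr_orthogonal_series _ _ _ P y (fun i => v * b i)) => //.
- by move=> i; exact: mark_sqr_integrable psiM (zenum i).
- move=> i j ij; apply: (marks_orthogonal Aindep Atau A1 A2 mpsi psiM).
  by apply: contra ij => /eqP/(can_inj zenumK) ->.
- by move=> i; rewrite (mark_second_moment Atau A2 mpsi psiM) bE -EFinM.
- exact: process_measurable.
- rewrite (_ : series _ = (fun n => v * series b n)); last first.
    by apply/funext => n; rewrite /series/= mulr_sumr.
  rewrite [lambda * v]mulrC -mulrA; apply: cvgM => //; exact: cvg_cst.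
- move: wE; apply: filterS => t wt.
  have := tempered_eval_cvg (psi := psi) wt; apply: cvg_trans; apply: near_eq_cvg; near=> K.
  rewrite -(sum_zenum (fun k => A k t * psi (tau k t))).
  exact: (tempered_sumE psi _ (fun i => A (i%:Z - K%:Z) t) (fun i => tau (i%:Z - K%:Z) t)).
Unshelve. all: by end_near. Qed.

End compound_poisson.

(** * Second moments of the filtered processes *)

Section polarization.
Context {R : realType} (d : measure_display) (T : measurableType d).
Local Notation leb := (@lebesgue_measure R).
Variables (P : probability T R) (w : generalized_process T R) (c : R).
Hypothesis w2 : forall psi : schwartz R,
  (\int[P]_t (w t psi ^+ 2)%:E = (c * \int[leb]_x (psi x ^+ 2))%:E)%E.

(** Polarization: x y = ((x + y)^2 - (x - y)^2) / 4, and w is linear. *)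
Lemma second_moment_polarization (phi psi : schwartz R) :
  ('E_P[(fun t => w t phi * w t psi)%R] =
   (c * ((\int[leb]_x ((phi + psi : schwartz R) x ^+ 2) -
     \int[leb]_x ((phi - psi : schwartz R) x ^+ 2)) / 4))%:E)%E.
Proof.
rewrite unlock.
have iw (psi' : schwartz R) : P.-integrable setT (EFin \o (fun t => w t psi' ^+ 2)).
  apply/integrableP; split.
    by apply/measurable_EFinP; apply: measurable_funX; exact: process_measurable.
  by under eq_integral do rewrite /= ger0_norm ?sqr_ge0//; rewrite w2 ltry.
have wD t : w t (phi + psi) = w t phi + w t psi.
  have [lw _] := temperedP (w t).
  by have := lw 1 phi psi; rewrite scale1r mul1r.
have wB t : w t (phi - psi) = w t phi - w t psi.
  have [lw _] := temperedP (w t).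
  by have := lw (-1) psi phi; rewrite scaleN1r mulN1r => h; rewrite addrC h addrC.
transitivity (\int[P]_t ((4^-1)%:E * ((w t (phi + psi) ^+ 2)%:E - (w t (phi - psi) ^+ 2)%:E)))%E.
  apply: eq_integral => t _; rewrite -EFinB -EFinM wD wB; congr EFin; by field.
rewrite integralZl//; last exact: (integrableB measurableT (iw _) (iw _)).
rewrite integralB_EFin// !w2 -EFinB -EFinM; congr EFin; ring.
Qed.

End polarization.

Theorem mainTheorem2 (R : realType)
  (* L = P(D) Q(D)^-1, its inverse, and the adjoint of the inverse *)
  (P Q : {poly R[i]}) (L Linv : tempered R -> tempered R)
  (Linv_adj : schwartz R -> schwartz R)
  (HL : rational_operator P Q L)
  (degPQ : (size Q < size P)%N)
  (kerL : trivial_null_space L)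
  (HLinv : inverse_operator P Q Linv)
  (HLinv_adj : adjoint_operator Linv Linv_adj)
  (* the white noise w *)
  (f : R -> R[i])
  (d : measure_display) (T : measurableType d) (Pr : probability T R)
  (w : generalized_process T R)
  (Hw : levy_white_noise Pr w f)
  (Xrect : {RV Pr >-> R})
  (HXrect : extended_value Pr w rect01 Xrect)
  (Xrect_mean : ('E_Pr[Xrect] = 0)%E)
  (Xrect_var : ('V_Pr[Xrect] < +oo)%E)
  (* the compound-Poisson innovation w_n *)
  (n : nat) (n_ge1 : (1 <= n)%N)
  (d' : measure_display) (T' : measurableType d') (Pr' : probability T' R)
  (tau A : int -> {RV Pr' >-> R})
  (wn : generalized_process T' R)
  (Hwn : compound_poisson_innovation (n%:R : R) tau A wn)
  (HA : forall k : int, has_levy_exponent (A k) (fun xi : R => n%:R^-1 * f xi))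
  (* s = L^-1 w and s_n = L^-1 w_n *)
  (s : generalized_process T R) (Hs : filtered_process Linv_adj w s)
  (sn : generalized_process T' R) (Hsn : filtered_process Linv_adj wn sn) :
  forall phi1 phi2 : schwartz R,
    ('E_Pr'[(fun t => sn t phi1 * sn t phi2)%R] =
     'E_Pr[(fun t => s t phi1 * s t phi2)%R])%E.
Proof.
move=> phi1 phi2.
have n0 : 0 < n%:R :> R by rewrite ltr0n.
have [s2 X2] := sqr_moment_of_variance Xrect_mean Xrect_var.
have X1 : (\int[Pr]_t (Xrect t)%:E = 0)%E by rewrite -expectation_def.
have w2 := white_noise_second_moment Hw HXrect X1 X2.
have nE : n%:R^-1 = (n%:R^-1 : R)%:C%C by rewrite fmorphV rmorph_nat.
have HA' k : has_levy_exponent (A k) (fun xi : R => (n%:R^-1)%:C%C * f xi).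
  by rewrite -nE; exact: HA.
have Amom k := amplitude_moments Hw HXrect X1 X2 (HA' k).
have wn2 psi := compound_poisson_second_moment n0 Hwn
  (fun k => (Amom k).1) (fun k => (Amom k).2) psi.
rewrite mulrA divff ?gt_eqF// mul1r in wn2.
under [in LHS]eq_fun do rewrite !Hsn.
under [in RHS]eq_fun do rewrite !Hs.
by rewrite (second_moment_polarization wn2) (second_moment_polarization w2).
Qed.
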